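(* Let $\mathcal{O}$ be an operad in chain complexes over a commutative ring $\Bbbk$, let $A,B$ be $\mathcal{O}$-algebras, and let $\mathbf{f}\colon A\to B$, $\mathbf{g}\colon B\to A$, $\mathbf{h}\colon A\to A$ be a contraction of $\mathcal{O}$-algebras. Let $\mathbf{t}$ be a perturbation of the $\mathcal{O}$-algebra $A$ such that the series $\mathbf{t}+\mathbf{t}\mathbf{h}\mathbf{t}+\mathbf{t}\mathbf{h}\mathbf{t}\mathbf{h}\mathbf{t}+\cdots$ converges, in the sense that $\mathbf{1}-\mathbf{h}\mathbf{t}$ is invertible (equivalently $\mathbf{1}-\mathbf{t}\mathbf{h}$ is invertible; the sum of the series is $\mathbf{t}(\mathbf{1}-\mathbf{h}\mathbf{t})^{-1}$). Then the recursive formulas $$\mathbf{f}'=\mathbf{f}+\mathbf{f}'\mathbf{t}\mathbf{h},\qquad \mathbf{g}'=\mathbf{g}+\mathbf{h}\mathbf{t}\mathbf{g}',\qquad \mathbf{h}'=\mathbf{h}+\mathbf{h}'\mathbf{t}\mathbf{h},\qquad \mathbf{t}'=\mathbf{f}\mathbf{t}\mathbf{g}'$$ define a perturbation $\mathbf{t}'$ of the $\mathcal{O}$-algebra $B$ and a contraction of $\mathcal{O}$-algebras $$\mathbf{f}'\colon (A,d_A+\mathbf{t}_1)\to (B,d_B+\mathbf{t}'_1),\quad \mathbf{g}'\colon (B,d_B+\mathbf{t}'_1)\to (A,d_A+\mathbf{t}_1),\quad \mathbf{h}'\colon (A,d_A+\mathbf{t}_1)\to (A,d_A+\mathbf{t}_1).$$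 In particular, $\mathbf{f}'$ and $\mathbf{g}'$ are morphisms, $\mathbf{t}'$ is a derivation and $\mathbf{h}'$ is a pseudo-derivation.
   Context: Chain complexes are unbounded complexes over a commutative ring $\Bbbk$, with differential of degree $-1$; the Koszul sign rule is used. A thick map $\mathbf{f}\colon A\to B$ of chain complexes is a sequence of $\Bbbk$-linear maps $\mathbf{f}_n\colon A^{\otimes n}\to B^{\otimes n}$, $n\ge 0$, all of the same degree $|\mathbf{f}|$. It is symmetric if each $\mathbf{f}_n$ is $\Sigma_n$-equivariant for permutation of tensor factors. Composition, sums and the differential $\partial(\mathbf{f})_n=d_{B^{\otimes n}}\mathbf{f}_n-(-1)^{|\mathbf{f}|}\mathbf{f}_nd_{A^{\otimes n}}$ are levelwise; $\mathbf{1}_n=1_{A^{\otimes n}}$, $\mathbf{0}_n=0$. If $A,B$ are $\mathcal{O}$-algebras (each $\mu\in\mathcal{O}(n)$ acts by $\mu_A\colon A^{\otimes n}\to A$), a thick map of $\mathcal{O}$-algebras $A\to B$ is a symmetric thick map with $\mathbf{f}_1\mu_A=(-1)^{|\mathbf{f}||\mu|}\mu_B\mathbf{f}_n$ for all $n$ and $\mu\in\mathcal{O}(n)$. $\mathcal{O}$-algebras and thick maps of $\mathcal{O}$-algebras form a dg-category. A thick map $\mathbf{f}$ is a morphism if $\mathbf{f}_{p+q}=\mathbf{f}_p\otimes\mathbf{f}_q$ for all $p,q\ge0$. A thick map $\mathbf{d}\colon A\to A$ is a derivation if $\mathbf{d}_{p+q}=\mathbf{d}_p\otimes 1+1\otimes\mathbf{d}_q$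 for all $p,q\ge 0$. A thick map $\mathbf{h}\colon A\to A$ (of degree $1$) is a pseudo-derivation if for all $p,q\ge0$ $$(\mathbf{h}_p\otimes 1-1\otimes\mathbf{h}_q)\mathbf{h}_{p+q}=\mathbf{h}_p\otimes\mathbf{h}_q,\qquad \mathbf{h}_{p+q}(\mathbf{h}_p\otimes 1-1\otimes\mathbf{h}_q)=-\mathbf{h}_p\otimes\mathbf{h}_q .$$ A contraction of $\mathcal{O}$-algebras consists of thick maps of $\mathcal{O}$-algebras $\mathbf{f}\colon A\to B$, $\mathbf{g}\colon B\to A$, $\mathbf{h}\colon A\to A$ with $|\mathbf{f}|=|\mathbf{g}|=0$, $|\mathbf{h}|=1$, such that $\partial(\mathbf{f})=\mathbf{0}$, $\partial(\mathbf{g})=\mathbf{0}$, $\partial(\mathbf{h})=\mathbf{g}\mathbf{f}-\mathbf{1}$, $\mathbf{f}\mathbf{g}=\mathbf{1}$, $\mathbf{f}\mathbf{h}=\mathbf{0}$, $\mathbf{h}\mathbf{h}=\mathbf{0}$, $\mathbf{h}\mathbf{g}=\mathbf{0}$, and such that $\mathbf{f},\mathbf{g}$ are morphisms and $\mathbf{h}$ is a pseudo-derivation. A perturbation of an $\mathcal{O}$-algebra $A$ is a thick map of $\mathcal{O}$-algebras $\mathbf{t}\colon A\to A$ of degree $-1$ which is a derivation and satisfies $\partial(\mathbf{t})+\mathbf{t}^2=\mathbf{0}$. Then $(A,d_A+\mathbf{t}_1)$ denotes $A$ with the new differential and the same $\mathcal{O}$-algebra structure maps. *)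

(* Defs.v *)
From HB Require Import structures.
From mathcomp Require Import all_fingroup all_boot all_order all_algebra.
From mathcomp Require Import boolp classical_sets functions cardinality fsbigop.

Set Implicit Arguments.
Unset Strict Implicit.
Unset Printing Implicit Defensive.

Import GRing.Theory.
Local Open Scope ring_scope.
Local Open Scope quotient_scope.

(* The n-fold tensor power A^{(x) n} of a k-module: formal sums of scalar
   multiples of n-tuples, two such sums being identified exactly when every
   n-linear map out of A^n takes the same value on them. [tlift_pure] and
   [tp_ext] below are its universal property. *)
Section TensorPower.
Variables (k : comPzRingType) (A : lmodType k) (n : nat).

Definition upd (a : {ffun 'I_n -> A}) (j : 'I_n) (x : A) : {ffun 'I_n -> A} :=
  [ffun i => if i == j then x else a i].

Definition multilinear (P : lmodType k) (phi : {ffun 'I_n -> A} -> P) : Prop :=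
  forall a j c x y,
    phi (upd a j (c *: x + y)) = c *: phi (upd a j x) + phi (upd a j y).

Definition fsum (P : lmodType k) (phi : {ffun 'I_n -> A} -> P)
    (s : seq (k * {ffun 'I_n -> A})) : P :=
  \sum_(u <- s) u.1 *: phi u.2.

Definition fsum_equiv (s t : seq (k * {ffun 'I_n -> A})) : bool :=
  `[< forall (P : lmodType k) (phi : {ffun 'I_n -> A} -> P),
        multilinear phi -> fsum phi s = fsum phi t >].

Lemma fsum_equiv_is_equiv : equiv_class_of fsum_equiv.
Proof.
split=> [s|s t|t s u].
- exact/asboolP.
- by apply/idP/idP => /asboolP H; apply/asboolP => P phi phiP; rewrite H.
- by move=> /asboolP H1 /asboolP H2; apply/asboolP => P phi phiP; rewrite H1 // H2.
Qed.

Definition fsum_equivr := EquivRelPack fsum_equiv_is_equiv.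

Definition TP := {eq_quot fsum_equivr}.
HB.instance Definition _ := EqQuotient.on TP.
HB.instance Definition _ := Choice.on TP.

Definition pure (a : {ffun 'I_n -> A}) : TP := \pi_TP [:: (1, a)].

(* The linear map out of TP induced by phi; meaningful for multilinear phi. *)
Definition tlift (P : lmodType k) (phi : {ffun 'I_n -> A} -> P) (x : TP) : P :=
  fsum phi (repr x).

Lemma tlift_pi (P : lmodType k) (phi : {ffun 'I_n -> A} -> P) s :
  multilinear phi -> tlift phi (\pi_TP s) = fsum phi s.
Proof.
move=> phiP; rewrite /tlift.
have /eqmodP/asboolP H : \pi_TP (repr (\pi_TP s)) = \pi_TP s by rewrite reprK.
exact: H.
Qed.

Lemma tp_eqP (x y : TP) :
  (forall (P : lmodType k) (phi : {ffun 'I_n -> A} -> P),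
     multilinear phi -> tlift phi x = tlift phi y) -> x = y.
Proof.
move=> H; rewrite -[x]reprK -[y]reprK; apply/eqmodP/asboolP => P phi phiP.
exact: H.
Qed.

Definition tp_zero : TP := \pi_TP [::].
Definition tp_scale (c : k) (x : TP) : TP :=
  \pi_TP [seq (c * u.1, u.2) | u <- repr x].
Definition tp_opp (x : TP) : TP := tp_scale (-1) x.
Definition tp_add (x y : TP) : TP := \pi_TP (repr x ++ repr y).

Section Tlift0.
Variables (P : lmodType k) (phi : {ffun 'I_n -> A} -> P).
Hypothesis phiP : multilinear phi.
Let L := tlift phi.

Let L0 : L tp_zero = 0.
Proof. by rewrite /L tlift_pi // /fsum big_nil. Qed.
Let LD x y : L (tp_add x y) = L x + L y.
Proof. by rewrite /L tlift_pi // /fsum big_cat. Qed.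
Let LZ c x : L (tp_scale c x) = c *: L x.
Proof.
rewrite /L tlift_pi // /fsum big_map scaler_sumr /tlift /fsum.
by apply: eq_bigr => u _; rewrite scalerA.
Qed.
Let LN x : L (tp_opp x) = - L x.
Proof. by rewrite LZ scaleN1r. Qed.
Definition tliftE := (L0, LD, LN, LZ).
End Tlift0.

Fact tp_addA : associative tp_add.
Proof. by move=> x y z; apply: tp_eqP => P phi H; rewrite !(tliftE H) addrA. Qed.
Fact tp_addC : commutative tp_add.
Proof. by move=> x y; apply: tp_eqP => P phi H; rewrite !(tliftE H) addrC. Qed.
Fact tp_add0 : left_id tp_zero tp_add.
Proof. by move=> x; apply: tp_eqP => P phi H; rewrite !(tliftE H) add0r. Qed.
Fact tp_addN : left_inverse tp_zero tp_opp tp_add.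
Proof. by move=> x; apply: tp_eqP => P phi H; rewrite !(tliftE H) addNr. Qed.

HB.instance Definition _ :=
  GRing.isZmodule.Build TP tp_addA tp_addC tp_add0 tp_addN.

Fact tp_scaleA c d x : tp_scale c (tp_scale d x) = tp_scale (c * d) x.
Proof. by apply: tp_eqP => P phi H; rewrite !(tliftE H) scalerA. Qed.
Fact tp_scale1 : left_id 1 tp_scale.
Proof. by move=> x; apply: tp_eqP => P phi H; rewrite !(tliftE H) scale1r. Qed.
Fact tp_scaleDr : right_distributive tp_scale +%R.
Proof. by move=> c x y; apply: tp_eqP => P phi H; rewrite !(tliftE H) scalerDr. Qed.
Fact tp_scaleDl x : {morph tp_scale^~ x : c d / c + d}.
Proof. by move=> c d; apply: tp_eqP => P phi H; rewrite !(tliftE H) scalerDl. Qed.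

HB.instance Definition _ :=
  GRing.Zmodule_isLmodule.Build k TP tp_scaleA tp_scale1 tp_scaleDr tp_scaleDl.

Lemma tlift_linear (P : lmodType k) (phi : {ffun 'I_n -> A} -> P) :
  multilinear phi -> linear (tlift phi).
Proof. by move=> H c x y; rewrite !(tliftE H). Qed.

Lemma tlift_pure (P : lmodType k) (phi : {ffun 'I_n -> A} -> P) a :
  multilinear phi -> tlift phi (pure a) = phi a.
Proof. by move=> H; rewrite tlift_pi // /fsum big_seq1 scale1r. Qed.

Lemma pure_multilinear : multilinear pure.
Proof.
move=> a j c x y; apply: tp_eqP => P phi H.
by rewrite !(tliftE H) !tlift_pure.
Qed.

Lemma linear_fsum (P : lmodType k) (F : TP -> P) s :
  linear F -> F (\sum_(u <- s) u.1 *: pure u.2) = fsum (F \o pure) s.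
Proof.
move=> linF; have F0 : F 0 = 0.
  by have := linF (-1) 0 0; rewrite !scaleN1r oppr0 add0r addNr.
elim: s => [|u s IH]; first by rewrite /fsum !big_nil.
by rewrite /fsum !big_cons linF IH.
Qed.

Lemma tp_span (x : TP) : x = \sum_(u <- repr x) u.1 *: pure u.2.
Proof.
apply: tp_eqP => P phi H.
rewrite (linear_fsum _ (tlift_linear H)) {1}/tlift /fsum.
by apply: eq_bigr => u _ /=; rewrite tlift_pure.
Qed.

Lemma tp_ext (P : lmodType k) (F G : TP -> P) :
  linear F -> linear G -> (forall a, F (pure a) = G (pure a)) -> F =1 G.
Proof.
move=> linF linG FG x; rewrite (tp_span x) !linear_fsum //.
by rewrite /fsum; apply: eq_bigr => u _ /=; rewrite FG.
Qed.

End TensorPower.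

(* A Z-graded k-module, as the direct sum of its homogeneous components, which
   are the images of the projections [gpr i]. *)
Record gmod (k : comPzRingType) := Gmod {
  gsort :> lmodType k;
  gpr : int -> gsort -> gsort;
  gpr_linear : forall i, linear (gpr i);
  gpr_gpr : forall i j a, gpr i (gpr j a) = if i == j then gpr j a else 0;
  gpr_finite : forall a, finite_set [set i | gpr i a != 0];
  gpr_sum : forall a, a = \sum_(i \in [set: int]) gpr i a
}.
Arguments gpr {k g}.

Section Graded.
Variable k : comPzRingType.
Implicit Types A B : gmod k.

(* (-1)^i *)
Definition ksgn (i : int) : k := (-1) ^+ absz i.

Definition hmg A (i : int) (a : A) : Prop := gpr i a = a.

(* the degree m part of A^{(x) n}: the span of the a_1 (x) ... (x) a_n with
   |a_1| + ... + |a_n| = m *)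
Definition thmg A n (m : int) (x : TP A n) : Prop :=
  exists s : seq (k * {ffun 'I_n -> A}),
    x = \sum_(u <- s) u.1 *: pure u.2 /\
    forall u, u \in s -> exists deg : 'I_n -> int,
      \sum_(j < n) deg j = m /\ forall j, hmg (deg j) (u.2 j).

Definition is_differential A (d : A -> A) : Prop :=
  [/\ linear d, (forall i a, hmg i a -> hmg (i - 1) (d a))
    & forall a, d (d a) = 0].

(* the even (b = false) and the odd (b = true) part of a *)
Definition gpar A (b : bool) (a : A) : A :=
  \sum_(i \in [set i : int | odd (absz i) = b]) gpr i a.

(* a |-> (-1)^(e |a|) a *)
Definition geps A (e : int) (a : A) : A := gpar false a + ksgn e *: gpar true a.

Definition teps A n (e : int) : TP A n -> TP A n :=
  tlift (fun a : {ffun 'I_n -> A} => pure [ffun j => geps e (a j)]).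

(* sum_j (-1)^(|a_1| + ... + |a_(j-1)|) a_1 (x) ... (x) d a_j (x) ... (x) a_n *)
Definition tdiff A (d : A -> A) n : TP A n -> TP A n :=
  tlift (fun a : {ffun 'I_n -> A} => \sum_(j < n)
    pure [ffun l : 'I_n =>
            if (l < j)%N then geps 1 (a l) else if l == j then d (a l) else a l]).

(* The number of inversions of s between odd factors. *)
Definition kinv n (s : 'S_n) (b : 'I_n -> bool) : nat :=
  \sum_(i < n) \sum_(j < n) [&& (i < j)%N, (s j < s i)%N, b i & b j].

(* The left action of S_n with Koszul sign, moving the j-th factor to the
   position s j; the factors are first split in even and odd part. *)
Definition tsym A n (s : 'S_n) : TP A n -> TP A n :=
  tlift (fun a : {ffun 'I_n -> A} => \sum_(b : {ffun 'I_n -> bool})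
    (-1) ^+ kinv s b *:
      pure [ffun j => gpar (b ((s^-1)%g j)) (a ((s^-1)%g j))]).

(* the concatenation A^{(x) p} x A^{(x) q} -> A^{(x) (p + q)} *)
Definition fcat A p q (a : {ffun 'I_p -> A}) (b : {ffun 'I_q -> A}) :
    {ffun 'I_(p + q) -> A} :=
  [ffun i => match fintype.split i with inl j => a j | inr j => b j end].

Definition tcat A p q (u : TP A p) (v : TP A q) : TP A (p + q) :=
  tlift (fun a : {ffun 'I_p -> A} =>
    tlift (fun b : {ffun 'I_q -> A} => pure (fcat a b)) v) u.

(* F (x) G for G of degree e: u (x) v |-> (-1)^(e |u|) F u (x) G v *)
Definition tens A B p q (e : int) (F : TP A p -> TP B p) (G : TP A q -> TP B q) :
    TP A (p + q) -> TP B (p + q) :=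
  tlift (fun a : {ffun 'I_(p + q) -> A} =>
    tcat (F (teps e (pure [ffun j => a (lshift q j)])))
         (G (pure [ffun j => a (rshift p j)]))).

(* the identification of A with A^{(x) 1} and its inverse *)
Definition tp1 A (a : A) : TP A 1 := pure [ffun => a].
Definition tp1V A : TP A 1 -> A := tlift (fun a : {ffun 'I_1 -> A} => a ord0).

Definition tmap A B := forall n, TP A n -> TP B n.

Definition tm_one A : tmap A A := fun _ x => x.
Definition tm_zero A B : tmap A B := fun _ _ => 0.
Definition tm_add A B (f g : tmap A B) : tmap A B := fun n x => f n x + g n x.
Definition tm_sub A B (f g : tmap A B) : tmap A B := fun n x => f n x - g n x.
Definition tm_comp A B C (f : tmap B C) (g : tmap A B) : tmap A C :=
  fun n x => f n (g n x).

(* the differential of a thick map of degree e *)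
Definition tm_diff A B (dA : A -> A) (dB : B -> B) (e : int) (f : tmap A B) :
    tmap A B :=
  fun n x => tdiff dB (f n x) - ksgn e *: f n (tdiff dA x).

Definition is_thick A B (e : int) (f : tmap A B) : Prop :=
  forall n, linear (f n) /\ forall m x, thmg m x -> thmg (m + e) (f n x).

Definition tm_symmetric A B (f : tmap A B) : Prop :=
  forall n (s : 'S_n) x, f n (tsym s x) = tsym s (f n x).

Definition tm_morphism A B (f : tmap A B) : Prop :=
  forall p q, f (p + q)%N = tens 0 (f p) (f q).

(* for d of degree e *)
Definition tm_derivation A (e : int) (d : tmap A A) : Prop :=
  forall p q (x : TP A (p + q)),
    d (p + q)%N x = tens 0 (d p) id x + tens e id (d q) x.

(* for h of degree 1 *)
Definition tm_pseudo_derivation A (h : tmap A A) : Prop :=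
  forall p q (x : TP A (p + q)),
    let D y := tens 0 (h p) id y - tens 1 id (h q) y in
    D (h (p + q)%N x) = tens 1 (h p) (h q) x /\
    h (p + q)%N (D x) = - tens 1 (h p) (h q) x.

Definition arity1 A B (f : tmap A B) (a : A) : B := tp1V (f 1%N (tp1 a)).

End Graded.

(* The operations above on homogeneous elements and on pure tensors. *)
Section GradedTheory.
Variable k : comPzRingType.
Implicit Types A B : gmod k.

Lemma gparE A b (a : A) (r : seq int) :
  uniq r -> (forall i, gpr i a != 0 -> i \in r) ->
  gpar b a = \sum_(i <- r | odd (absz i) == b) gpr i a.
Proof.
move=> ur Hr; rewrite bigfs //; last first.
  by move=> i _; apply: contraNeq; apply: Hr.
rewrite /gpar; congr bigop; congr finite_support.
by apply/seteqP; split=> i /= /eqP.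
Qed.

Lemma gpr_supp A (a b : A) : exists r : seq int, uniq r /\
  forall i, (gpr i a != 0 -> i \in r) /\ (gpr i b != 0 -> i \in r).
Proof.
exists (undup (finmap.enum_fset (fset_set [set i | gpr i a != 0]) ++
               finmap.enum_fset (fset_set [set i | gpr i b != 0]))).
split=> [|i]; first exact: undup_uniq.
rewrite mem_undup mem_cat; have Ha := in_fset_set (gpr_finite a) i.
have Hb := in_fset_set (gpr_finite b) i; rewrite [X in X || _]Ha [X in _ || X]Hb.
by split=> Hi; apply/orP; [left|right]; rewrite inE.
Qed.

Lemma gpar_linear A b : linear (@gpar k A b).
Proof.
move=> c x y; have [r [ur Hr]] := gpr_supp x y.
have Hxy i : gpr i (c *: x + y) != 0 -> i \in r.
  apply: contraR => Hi; rewrite gpr_linear.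
  have /contraR/(_ Hi)/eqP -> := (Hr i).1.
  by have /contraR/(_ Hi)/eqP -> := (Hr i).2; rewrite scaler0 addr0.
rewrite !(gparE _ ur) //; try by move=> i; case: (Hr i).
rewrite scaler_sumr -big_split.
by apply: eq_bigr => i _; rewrite gpr_linear.
Qed.

Lemma gpar_hmg A b i (a : A) :
  hmg i a -> gpar b a = if odd (absz i) == b then a else 0.
Proof.
move=> ai; rewrite (@gparE _ _ _ [:: i]) //.
  by rewrite big_mkcond big_seq1 ai.
move=> j; rewrite inE; apply: contraR => ij.
by rewrite -ai gpr_gpr (negbTE ij) eqxx.
Qed.

Lemma gpar_sum A (a : A) : a = gpar false a + gpar true a.
Proof.
have [r [ur Hr]] := gpr_supp a a.
have Hr' i : gpr i a != 0 -> i \in r by case: (Hr i).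
rewrite !(gparE _ ur) // [LHS]gpr_sum.
have -> : \sum_(i \in [set: int]) gpr i a = \sum_(i <- r) gpr i a.
  rewrite (bigfs _ ur); last by move=> i _; apply: contraNeq; apply: Hr'.
  by congr bigop; congr finite_support; apply/seteqP.
rewrite (bigID (fun i => odd (absz i) == false)) /=; congr (_ + _).
by apply: eq_bigl => i; case: odd.
Qed.

Lemma ksgn_odd (i : int) : ksgn k i = if odd (absz i) then -1 else 1.
Proof. by rewrite /ksgn -signr_odd; case: odd; rewrite ?expr1 ?expr0. Qed.

Lemma geps_linear A e : linear (@geps k A e).
Proof.
move=> c x y; rewrite /geps !gpar_linear scalerDr !scalerA [_ * c]mulrC.
by rewrite scalerDr !scalerA addrACA.
Qed.

Lemma geps_hmg A e i (a : A) : hmg i a -> geps e a = ksgn k (e * i) *: a.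
Proof.
move=> ai; rewrite /geps !(gpar_hmg _ ai) !ksgn_odd abszM oddM.
by case: (odd `|i|); case: (odd `|e|) => /=;
  rewrite ?scale1r ?add0r ?scaler0 ?addr0.
Qed.

Lemma pure_multilinear_comp A B n (F : 'I_n -> A -> B) :
  (forall j, linear (F j)) ->
  multilinear (fun a : {ffun 'I_n -> A} => pure [ffun j => F j (a j)]).
Proof.
move=> linF a j c x y.
have E z : [ffun i => F i (upd a j z i)] = upd [ffun i => F i (a i)] j (F j z).
  by apply/ffunP => i; rewrite !ffunE; case: eqP => [->|].
by rewrite !E linF pure_multilinear.
Qed.

Lemma teps_linear A n e : linear (@teps k A n e).
Proof. exact/tlift_linear/(pure_multilinear_comp (fun=> @geps_linear A e)). Qed.

Lemma teps_pure A n e (a : {ffun 'I_n -> A}) :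
  teps e (pure a) = pure [ffun j => geps e (a j)].
Proof.
exact: (tlift_pure _ (pure_multilinear_comp (fun=> @geps_linear A e))).
Qed.

Lemma tdiff_multilinear A (d : A -> A) n : linear d ->
  multilinear (fun a : {ffun 'I_n -> A} => \sum_(j < n)
    pure [ffun l : 'I_n =>
            if (l < j)%N then geps 1 (a l) else if l == j then d (a l) else a l]).
Proof.
move=> lind a j c x y; rewrite scaler_sumr -big_split; apply: eq_bigr => i _.
pose F (l : 'I_n) (z : A) :=
  if (l < i)%N then geps 1 z else if l == i then d z else z.
apply: (@pure_multilinear_comp A A n F) => l {}c {}x {}y; rewrite /F.
by case: ifP => _; [exact: geps_linear | case: ifP => _ //; exact: lind].
Qed.

Lemma tdiff_pure A (d : A -> A) n (a : {ffun 'I_n -> A}) : linear d ->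
  tdiff d (pure a) = \sum_(j < n)
    pure [ffun l : 'I_n =>
            if (l < j)%N then geps 1 (a l) else if l == j then d (a l) else a l].
Proof. by move=> lind; rewrite /tdiff tlift_pure //; apply: tdiff_multilinear. Qed.

Lemma tsym_multilinear A n (s : 'S_n) :
  multilinear (fun a : {ffun 'I_n -> A} => \sum_(b : {ffun 'I_n -> bool})
    (-1) ^+ kinv s b *:
      pure [ffun j => gpar (b ((s^-1)%g j)) (a ((s^-1)%g j))] : TP A n).
Proof.
move=> a j c x y; rewrite scaler_sumr -big_split; apply: eq_bigr => b _ /=.
have E z : [ffun i => gpar (b ((s^-1)%g i)) (upd a j z ((s^-1)%g i))] =
    upd [ffun i => gpar (b ((s^-1)%g i)) (a ((s^-1)%g i))] (s j) (gpar (b j) z).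
  apply/ffunP => i; rewrite !ffunE.
  have -> : (((s^-1)%g i) == j) = (i == s j).
    by rewrite -(inj_eq (@perm_inj _ s)) permKV.
  by case: eqP => [->|//]; rewrite permK.
rewrite !E gpar_linear pure_multilinear scalerDr !scalerA.
by rewrite [_ * c]mulrC.
Qed.

Lemma pure_0 A n (a : {ffun 'I_n -> A}) j : a j = 0 -> pure a = 0.
Proof.
move=> aj; have := @pure_multilinear k A n a j 1 0 0.
have -> : upd a j 0 = a by apply/ffunP => i; rewrite ffunE; case: eqP => [->|].
have -> : upd a j (1 *: 0 + 0) = a.
  by apply/ffunP => i; rewrite ffunE scaler0 addr0; case: eqP => [->|].
by rewrite scale1r => H; apply: (addrI (pure a)); rewrite addr0 -H.
Qed.

Lemma tsym_linear A n (s : 'S_n) : linear (@tsym k A n s).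
Proof. exact/tlift_linear/tsym_multilinear. Qed.

Lemma tsym_hmg A n (s : 'S_n) (deg : 'I_n -> int) (a : {ffun 'I_n -> A}) :
  (forall j, hmg (deg j) (a j)) ->
  tsym s (pure a) =
    (-1) ^+ kinv s (fun j => odd (absz (deg j))) *:
      pure [ffun j => a ((s^-1)%g j)].
Proof.
move=> Ha; rewrite /tsym (tlift_pure _ (tsym_multilinear s)).
pose b0 : {ffun 'I_n -> bool} := [ffun j => odd (absz (deg j))].
rewrite (bigD1 b0) //= [X in _ + X]big1 ?addr0.
  congr (_ *: pure _); first congr (_ ^+ _).
    by apply: eq_bigr => i _; apply: eq_bigr => j _; rewrite !ffunE.
  by apply/ffunP => j; rewrite !ffunE (gpar_hmg _ (Ha _)) eqxx.
move=> b bb0.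
have [j bj] : exists j, b j != b0 j.
  apply/existsP; rewrite -negb_forall; apply: contra bb0 => /forallP H.
  by apply/eqP/ffunP => j; apply/eqP.
rewrite (@pure_0 _ _ _ (s j)) ?scaler0 // ffunE permK (gpar_hmg _ (Ha j)).
by move: bj; rewrite ffunE eq_sym => /negbTE ->.
Qed.

Lemma fcat_updl A p q (a : {ffun 'I_p -> A}) (b : {ffun 'I_q -> A}) j x :
  fcat (upd a j x) b = upd (fcat a b) (lshift q j) x.
Proof.
apply/ffunP => i; rewrite !ffunE.
case: fintype.splitP => l El; rewrite ?ffunE.
  by congr (if _ then _ else _); rewrite -!val_eqE /= El.
by rewrite -val_eqE /= El gtn_eqF // ltn_addr.
Qed.

Lemma fcat_updr A p q (a : {ffun 'I_p -> A}) (b : {ffun 'I_q -> A}) j x :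
  fcat a (upd b j x) = upd (fcat a b) (rshift p j) x.
Proof.
apply/ffunP => i; rewrite !ffunE.
case: fintype.splitP => l El; rewrite ?ffunE.
  by rewrite -val_eqE /= El ltn_eqF // ltn_addr.
by congr (if _ then _ else _); rewrite -!val_eqE /= El eqn_add2l.
Qed.

Lemma tcat_multilinearr A p q (a : {ffun 'I_p -> A}) :
  multilinear (fun b : {ffun 'I_q -> A} => pure (fcat a b)).
Proof. by move=> b j c x y; rewrite !fcat_updr pure_multilinear. Qed.

Lemma tcat_multilinearl A p q (v : TP A q) :
  multilinear (fun a : {ffun 'I_p -> A} =>
    tlift (fun b : {ffun 'I_q -> A} => pure (fcat a b)) v).
Proof.
move=> a j c x y; rewrite /tlift /fsum scaler_sumr -big_split /=.
apply: eq_bigr => u _; rewrite !fcat_updl pure_multilinear scalerDr !scalerA.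
by rewrite [_ * c]mulrC.
Qed.

Lemma tcat_linearl A p q (v : TP A q) : linear (fun u : TP A p => tcat u v).
Proof. exact/tlift_linear/tcat_multilinearl. Qed.

Lemma tcat_pure A p q (a : {ffun 'I_p -> A}) (b : {ffun 'I_q -> A}) :
  tcat (pure a) (pure b) = pure (fcat a b).
Proof.
rewrite /tcat (tlift_pure _ (tcat_multilinearl _)).
exact: (tlift_pure _ (tcat_multilinearr _)).
Qed.

Lemma tcat_linearr A p q (u : TP A p) : linear (@tcat k A p q u).
Proof.
have E v : tcat u v =
  \sum_(w <- repr u) w.1 *: tlift (fun b => pure (fcat w.2 b)) v by [].
move=> c x y; rewrite !E scaler_sumr -big_split /=; apply: eq_bigr => w _.
rewrite (tlift_linear (tcat_multilinearr _)) scalerDr !scalerA.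
by rewrite [_ * c]mulrC.
Qed.

Lemma tens_multilinear A B p q e (F : TP A p -> TP B p) (G : TP A q -> TP B q) :
  linear F -> linear G ->
  multilinear (fun a : {ffun 'I_(p + q) -> A} =>
    tcat (F (teps e (pure [ffun j => a (lshift q j)])))
         (G (pure [ffun j => a (rshift p j)]))).
Proof.
move=> linF linG a j c x y.
case: (fintype.split_ordP j) => l ->.
  have El z : [ffun i => upd a (lshift q l) z (lshift q i)] =
      upd [ffun i => a (lshift q i)] l z.
    by apply/ffunP => i; rewrite !ffunE (inj_eq (@lshift_inj _ _)).
  have Er z : [ffun i => upd a (lshift q l) z (rshift p i)] =
      [ffun i => a (rshift p i)].
    by apply/ffunP => i; rewrite !ffunE eq_rlshift.
  by rewrite !El !Er pure_multilinear teps_linear linF tcat_linearl.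
have El z : [ffun i => upd a (rshift p l) z (lshift q i)] =
    [ffun i => a (lshift q i)].
  by apply/ffunP => i; rewrite !ffunE eq_lrshift.
have Er z : [ffun i => upd a (rshift p l) z (rshift p i)] =
    upd [ffun i => a (rshift p i)] l z.
  by apply/ffunP => i; rewrite !ffunE (inj_eq (@rshift_inj _ _)).
by rewrite !El !Er pure_multilinear linG tcat_linearr.
Qed.

Lemma tens_linear A B p q e (F : TP A p -> TP B p) (G : TP A q -> TP B q) :
  linear F -> linear G -> linear (tens e F G).
Proof. by move=> linF linG; apply/tlift_linear/tens_multilinear. Qed.

Lemma tens_tcat A B p q e (F : TP A p -> TP B p) (G : TP A q -> TP B q) u v :
  linear F -> linear G -> tens e F G (tcat u v) = tcat (F (teps e u)) (G v).
Proof.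
move=> linF linG.
pose L1 u := tens e F G (tcat u v); pose L2 u := tcat (F (teps e u)) (G v).
rewrite -/(L1 u) -/(L2 u); apply: (@tp_ext _ _ _ _ L1 L2).
- by move=> c x y; rewrite /L1 tcat_linearl tens_linear.
- by move=> c x y; rewrite /L2 teps_linear linF tcat_linearl.
move=> a; rewrite /L1 /L2 {L1 L2}.
pose L1 v := tens e F G (tcat (pure a) v).
pose L2 v := tcat (F (teps e (pure a))) (G v).
rewrite -/(L1 v) -/(L2 v); apply: (@tp_ext _ _ _ _ L1 L2).
- by move=> c x y; rewrite /L1 tcat_linearr tens_linear.
- by move=> c x y; rewrite /L2 linG tcat_linearr.
move=> b; rewrite /L1 /L2 tcat_pure /tens.
rewrite (tlift_pure _ (tens_multilinear e linF linG)).
congr (tcat (F (teps e (pure _))) (G (pure _))); apply/ffunP => i.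
  by rewrite !ffunE (unsplitK (inl i)).
by rewrite !ffunE (unsplitK (inr i)).
Qed.

Lemma tp1V_multilinear A : multilinear (fun a : {ffun 'I_1 -> A} => a ord0).
Proof. by move=> a j c x y; rewrite !ffunE (ord1 j) eqxx. Qed.

Lemma tp1K A : cancel (@tp1 k A) (@tp1V k A).
Proof.
by move=> a; rewrite /tp1V (tlift_pure _ (@tp1V_multilinear A)) ffunE.
Qed.

Lemma tp1VK A : cancel (@tp1V k A) (@tp1 k A).
Proof.
have lin1 : linear (@tp1 k A).
  move=> c x y; rewrite /tp1.
  have E z : [ffun=> z] = upd [ffun=> 0] ord0 z :> {ffun 'I_1 -> A}.
    by apply/ffunP => i; rewrite !ffunE ord1.
  by rewrite (E (_ + _)) (E x) (E y) pure_multilinear.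
move=> x; apply: (tp_ext (F := fun x => tp1 (tp1V x)) (G := id)) => [c u v|//|a].
  by have /= := tlift_linear (@tp1V_multilinear A) c u v;
    rewrite -/(tp1V _) => ->; rewrite lin1.
rewrite /tp1 /tp1V (tlift_pure _ (@tp1V_multilinear A)) /=.
have -> : [ffun=> a ord0] = a; last by [].
by apply/ffunP => i; rewrite ffunE (ord1 i).
Qed.

End GradedTheory.

Declare Scope thick_scope.
Delimit Scope thick_scope with thick.
Bind Scope thick_scope with tmap.
Notation "1" := (@tm_one _ _) : thick_scope.
Notation "0" := (@tm_zero _ _ _) : thick_scope.
Notation "f + g" := (tm_add f g) : thick_scope.
Notation "f - g" := (tm_sub f g) : thick_scope.
Notation "f * g" := (tm_comp f g) : thick_scope.

(* r is the permutation s o_i t of the inputs of a partial composite: it maps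
   the block of length n at i by t onto the block of length n at s i, and the
   other inputs by s. *)
Definition block_perm m n r (i : 'I_m) (s : 'S_m) (t : 'S_n) (u : 'S_r) : Prop :=
  let pos (i j : 'I_m) : nat := if (j < i)%N then val j else (j + n).-1 in
  (forall (j : 'I_m) (x : 'I_r), j != i -> x = pos i j :> nat ->
     u x = pos (s i) (s j) :> nat) /\
  (forall (j : 'I_n) (x : 'I_r), x = (i + j)%N :> nat ->
     u x = (s i + t j)%N :> nat).

(* Operads in chain complexes, with partial compositions
   o_i : O(m) (x) O(n) -> O(m + n - 1), inputs being numbered from 0. *)
Record operad (k : comPzRingType) := Operad {
  oper :> nat -> gmod k;
  odiff : forall n, oper n -> oper n;
  oid : oper 1;
  ocomp : forall m n r (i : 'I_m), r.+1 = (m + n)%N ->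
    oper m -> oper n -> oper r;
  osym : forall n, oper n -> 'S_n -> oper n;
  odiffP : forall n, is_differential (@odiff n);
  oid_hmg : hmg 0 oid;
  oid_diff : odiff oid = 0;
  ocomp_linearl : forall m n r (i : 'I_m) (e : r.+1 = (m + n)%N) mu,
    linear (fun la => ocomp i e la mu);
  ocomp_linearr : forall m n r (i : 'I_m) (e : r.+1 = (m + n)%N) la,
    linear (ocomp i e la);
  ocomp_hmg : forall m n r (i : 'I_m) (e : r.+1 = (m + n)%N) p q la mu,
    hmg p la -> hmg q mu -> hmg (p + q) (ocomp i e la mu);
  ocomp_diff : forall m n r (i : 'I_m) (e : r.+1 = (m + n)%N) p la mu,
    hmg p la ->
    odiff (ocomp i e la mu) =
      ocomp i e (odiff la) mu + ksgn k p *: ocomp i e la (odiff mu);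
  ocomp_idl : forall n (e : n.+1 = (1 + n)%N) mu, ocomp ord0 e oid mu = mu;
  ocomp_idr : forall m (i : 'I_m) (e : m.+1 = (m + 1)%N) la,
    ocomp i e la oid = la;
  ocomp_seq : forall l m n r s t (i : 'I_l) (j : 'I_m) (ij : 'I_r)
    (e1 : r.+1 = (l + m)%N) (e2 : t.+1 = (r + n)%N)
    (e3 : s.+1 = (m + n)%N) (e4 : t.+1 = (l + s)%N) la mu nu,
    ij = (i + j)%N :> nat ->
    ocomp ij e2 (ocomp i e1 la mu) nu = ocomp i e4 la (ocomp j e3 mu nu);
  ocomp_par : forall l m n r s t (i j : 'I_l) (j' : 'I_r) (i' : 'I_s)
    (e1 : r.+1 = (l + m)%N) (e2 : t.+1 = (r + n)%N)
    (e3 : s.+1 = (l + n)%N) (e4 : t.+1 = (s + m)%N) p q la mu nu,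
    (i < j)%N -> j' = (j + m).-1 :> nat -> i' = i :> nat ->
    hmg p mu -> hmg q nu ->
    ocomp j' e2 (ocomp i e1 la mu) nu =
      ksgn k (p * q) *: ocomp i' e4 (ocomp j e3 la nu) mu;
  osym_linear : forall n (s : 'S_n), linear (fun mu => osym mu s);
  osym_hmg : forall n (s : 'S_n) p mu, hmg p mu -> hmg p (osym mu s);
  osym_diff : forall n (s : 'S_n) mu, odiff (osym mu s) = osym (odiff mu) s;
  osym_1 : forall n (mu : oper n), osym mu 1%g = mu;
  (* a right action: (t * s)%g is "s after t" *)
  osym_M : forall n (s t : 'S_n) mu, osym (osym mu s) t = osym mu (t * s)%g;
  ocomp_sym : forall m n r (i : 'I_m) (e : r.+1 = (m + n)%N)
    (s : 'S_m) (t : 'S_n) (u : 'S_r) la mu,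
    block_perm i s t u ->
    ocomp i e (osym la s) (osym mu t) = osym (ocomp (s i) e la mu) u
}.
Arguments odiff {k} o {n}.
Arguments osym {k} o {n}.
Arguments ocomp {k} o {m n r}.

Section Algebras.
Variables (k : comPzRingType) (O : operad k).

(* The data of an O-algebra; its axioms are [is_oalg]. *)
Record oalg_data := OAlgData {
  acar :> gmod k;
  adiff : acar -> acar;
  aact : forall n, O n -> TP acar n -> acar
}.
Arguments aact {o n}.

Definition fnth (A : gmod k) n (a : {ffun 'I_n -> A}) (x : nat) : A :=
  oapp a 0 (insub x : option 'I_n).

Record is_oalg (A : oalg_data) : Prop := {
  adiffP : is_differential (@adiff A);
  aact_linearl : forall n (x : TP A n), linear (fun mu : O n => aact mu x);
  aact_linearr : forall n (mu : O n), linear (@aact A n mu);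
  aact_hmg : forall n p q (mu : O n) (x : TP A n),
    hmg p mu -> thmg q x -> hmg (p + q) (aact mu x);
  aact_diff : forall n p (mu : O n) (x : TP A n), hmg p mu ->
    aact (odiff O mu) x =
      adiff (aact mu x) - ksgn k p *: aact mu (tdiff (@adiff A) x);
  aact_id : forall a : A, aact (oid O) (tp1 a) = a;
  aact_sym : forall n (mu : O n) (s : 'S_n) (x : TP A n),
    aact (osym O mu s) x = aact mu (tsym s x);
  (* aact (la o_i mu) = aact la o (1^{(x) i} (x) aact mu (x) 1^{(x) (m-i-1)}) *)
  aact_comp : forall m n r (i : 'I_m) (e : r.+1 = (m + n)%N) q
    (la : O m) (mu : O n) (a : {ffun 'I_r -> A}), hmg q mu ->
    aact (ocomp O i e la mu) (pure a) =
      aact la (pure [ffun j : 'I_m =>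
        if (j < i)%N then geps q (fnth a j)
        else if j == i then aact mu (pure [ffun l : 'I_n => fnth a (i + l)%N])
        else fnth a (j + n).-1])
}.

Definition is_oalg_thick (A B : oalg_data) (e : int) (f : tmap A B) : Prop :=
  [/\ is_thick e f, tm_symmetric f
    & forall n p (mu : O n) (x : TP A n), hmg p mu ->
        arity1 f (aact mu x) = ksgn k (e * p) *: aact mu (f n x)].

Record contraction (A B : oalg_data) (f : tmap A B) (g : tmap B A)
    (h : tmap A A) : Prop := {
  contr_f : is_oalg_thick 0 f;
  contr_g : is_oalg_thick 0 g;
  contr_h : is_oalg_thick 1 h;
  contr_df : tm_diff (@adiff A) (@adiff B) 0 f = 0%thick;
  contr_dg : tm_diff (@adiff B) (@adiff A) 0 g = 0%thick;
  contr_dh : tm_diff (@adiff A) (@adiff A) 1 h = (g * f - 1)%thick;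
  contr_fg : (f * g = 1)%thick;
  contr_fh : (f * h = 0)%thick;
  contr_hh : (h * h = 0)%thick;
  contr_hg : (h * g = 0)%thick;
  contr_f_morphism : tm_morphism f;
  contr_g_morphism : tm_morphism g;
  contr_h_pseudo_derivation : tm_pseudo_derivation h
}.

Record perturbation (A : oalg_data) (t : tmap A A) : Prop := {
  pert_t : is_oalg_thick (-1) t;
  pert_derivation : tm_derivation (-1) t;
  pert_eq : (tm_diff (@adiff A) (@adiff A) (-1) t + t * t = 0)%thick
}.

(* (A, d_A + t_1) *)
Definition perturb (A : oalg_data) (t : tmap A A) : oalg_data :=
  @OAlgData A (fun a => adiff a + arity1 t a) (@aact A).

Definition tm_invertible (A : oalg_data) (f : tmap A A) : Prop :=
  exists s : tmap A A,
    [/\ is_thick 0 s, (s * f = 1)%thick & (f * s = 1)%thick].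

Record recursive_formulas (A B : oalg_data) (f : tmap A B) (g : tmap B A)
    (h t : tmap A A) (f' : tmap A B) (g' : tmap B A) (h' : tmap A A)
    (t' : tmap B B) : Prop := {
  rec_f_thick : is_thick 0 f';
  rec_g_thick : is_thick 0 g';
  rec_h_thick : is_thick 1 h';
  rec_t_thick : is_thick (-1) t';
  rec_f : (f' = f + f' * t * h)%thick;
  rec_g : (g' = g + h * t * g')%thick;
  rec_h : (h' = h + h' * t * h)%thick;
  rec_t : (t' = f * t * g')%thick
}.

End Algebras.

(* Main.v *)
From HB Require Import structures.
Require Import Defs.
From mathcomp Require Import all_fingroup all_boot all_order all_algebra.
From mathcomp Require Import boolp classical_sets fsbigop zify.
From Stdlib Require Ncring Ncring_tac.

(* Put u = (1 - ht)^-1 and v = (1 - th)^-1 = 1 + tuh.  The recursive formulas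
   force f' = fv, g' = ug, h' = uh and t' = ftug, and since fg = 1 everything
   can be checked, in each arity, in the ring of endomorphisms of A^{(x) n},
   with the idempotent e = gf in place of B.  Differentiating the two
   pseudo-derivation identities gives
     (e (x) 1) h = e (x) h = h (e (x) 1),  (1 (x) e) h = h (x) e = h (1 (x) e).
   Together with the pseudo-derivation identities these show
     (ev (x) ev)(1 - th) = e (x) e  and  (1 - ht)(ue (x) ue) = e (x) e,
   that is, f' and g' are morphisms; that h' is a pseudo-derivation follows in
   the same way.  Compatibility with the operad is inherited by u, being the
   inverse of a compatible map, and then by all composites. *)

Set Implicit Arguments.
Unset Strict Implicit.
Unset Printing Implicit Defensive.

Import GRing.Theory.
Local Open Scope ring_scope.

Ltac ncr := Ncring_tac.non_commutative_ring.

(** * The perturbation lemma in a ring *)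

Section NoncommutativeRing.
Variable R : pzRingType.

(** Presents a MathComp ring in the format of [Ncring], with Leibniz equality, so that [ncr] decides
    identities between noncommutative polynomials. *)
#[local] Instance pzRing_ops :
  @Ncring.Ring_ops R 0 1 +%R *%R (fun a b => a - b) -%R (@eq R).
Defined.

#[local] Instance pzRing_ring : Ncring.Ring (Ro := pzRing_ops).
Proof.
split; first exact: RelationClasses.eq_equivalence.
- by move=> a b -> c d ->.
- by move=> a b -> c d ->.
- by move=> a b -> c d ->.
- by move=> a b ->.
- exact: add0r.
- exact: addrC.
- exact: addrA.
- exact: mul1r.
- exact: mulr1.
- exact: mulrA.
- by move=> x y z; exact: mulrDl.
- by move=> x y z; exact: mulrDr.
- by [].
- exact: addrN.
Qed.

(* Equalities are deduced from hypotheses l = r by exhibiting x - y as a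
   combination of the l - r, a free identity that [ncr] checks. *)
Lemma eqr_comb (x y l r : R) : l = r -> x - y = l - r -> x = y.
Proof. by move=> -> /eqP; rewrite subrr subr_eq0 => /eqP. Qed.

Lemma eqrD (x y l r : R) : x = y -> l = r -> x + l = y + r.
Proof. by move=> -> ->. Qed.

(** Together with [eqrD] it reaches every element of the two-sided ideal generated by the
    differences l - r. *)
Lemma eqrM (a b x y : R) : x = y -> a * x * b = a * y * b.
Proof. by move=> ->. Qed.

Local Notation "H &+ K" := (eqrD H K) (at level 50, left associativity).

(* The projection onto the smaller complex is replaced by the idempotent e. *)
Record perturbed_contraction (d t h e u : R) : Prop := {
  pc_ee : e * e = e;
  pc_eh : e * h = 0;
  pc_he : h * e = 0;
  pc_hh : h * h = 0;
  pc_de : d * e = e * d;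
  pc_dh : d * h + h * d = e - 1;
  pc_dt : d * t + t * d + t * t = 0;
  pc_ul : u * (1 - h * t) = 1;
  pc_ur : (1 - h * t) * u = 1
}.

Section PerturbationLemma.
Variables d t h e u : R.
Hypothesis pc : perturbed_contraction d t h e u.
Let v := 1 + t * u * h.

Let ulE : u = 1 + u * h * t.
Proof. apply: (eqr_comb (pc_ul pc)); ncr. Qed.
Let urE : u = 1 + h * t * u.
Proof. apply: (eqr_comb (pc_ur pc)); ncr. Qed.

(** The inverse of 1 - th comes from that of 1 - ht: the equation u(1 - ht) = 1 is multiplied by t
    on the left and by h on the right. *)
Lemma pc_vl : v * (1 - t * h) = 1.
Proof. apply: (eqr_comb (eqrM t h (pc_ul pc))); rewrite /v; ncr. Qed.
Lemma pc_vr : (1 - t * h) * v = 1.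
Proof. apply: (eqr_comb (eqrM t h (pc_ur pc))); rewrite /v; ncr. Qed.

Lemma pc_hv : h * v = u * h.
Proof. apply: (eqr_comb (eqrM (-1) h (pc_ur pc))); rewrite /v; ncr. Qed.

Lemma pc_tu : t * u = v * t.
Proof. apply: (eqr_comb (eqrM t 1 (pc_ul pc))); rewrite /v; ncr. Qed.

Lemma pc_huh : h * (u * h) = 0.
Proof. by rewrite -pc_hv mulrA (pc_hh pc) mul0r. Qed.

Lemma pc_huhn : u * h * (u * h) = 0.
Proof. by rewrite -mulrA pc_huh mulr0. Qed.

(** In u = 1 + htu the second summand starts with h, so h and e on the left kill it; [pc_eue] holds
    for the same reason. *)
Lemma pc_hue : h * (u * e) = 0.
Proof.
rewrite urE; apply: (eqr_comb (pc_he pc &+ eqrM 1 (t * u * e) (pc_hh pc))).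
ncr.
Qed.

Lemma pc_evh : e * v * h = 0.
Proof.
apply: (eqr_comb (pc_eh pc &+ eqrM (e * t * u) 1 (pc_hh pc))).
rewrite /v; ncr.
Qed.

Lemma pc_eue : e * (u * e) = e.
Proof.
rewrite urE; apply: (eqr_comb (pc_ee pc &+ eqrM 1 (t * u * e) (pc_eh pc))).
ncr.
Qed.

(** This becomes f'g' = 1: in v = 1 + tuh the second summand ends with h, which kills ue. *)
Lemma pc_evue : e * v * (u * e) = e.
Proof.
apply: (eqr_comb (pc_eue &+ eqrM (e * t * u) 1 pc_hue)); rewrite /v; ncr.
Qed.

Lemma pc_evuh : e * v * (u * h) = 0.
Proof. by rewrite -pc_hv mulrA pc_evh mul0r. Qed.

Lemma pc_uhue : u * h * (u * e) = 0.
Proof. by rewrite -mulrA pc_hue mulr0. Qed.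

(** Says that g' is a chain map for the perturbed differentials, with ue in place of g' and etue in
    place of t'. *)
Lemma pc_d_ue : (d + t) * (u * e) = u * e * d + u * e * t * (u * e).
Proof.
(* The perturbation equation and dh + hd = e - 1 give (1 - ht)(d + t) = d(1 - ht) + et. *)
have E : (1 - h * t) * ((d + t) * (u * e)) = e * d + e * t * (u * e).
  apply: (eqr_comb (eqrM (- h) (u * e) (pc_dt pc) &+
      eqrM 1 (t * (u * e)) (pc_dh pc) &+ eqrM d e (pc_ur pc) &+ pc_de pc)).
  ncr.
apply: (eqr_comb (eqrM u 1 E &+ eqrM (-1) ((d + t) * (u * e)) (pc_ul pc))); ncr.
Qed.

(** Mirror image of [pc_d_ue], for f': here (d + t)(1 - th) = (1 - th)d + te. *)
Lemma pc_ev_d : e * v * (d + t) = d * (e * v) + e * t * (u * e) * (e * v).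
Proof.
have E : e * v * (d + t) * (1 - t * h) = e * d + e * v * t * e.
  apply: (eqr_comb (eqrM (- (e * v)) h (pc_dt pc) &+
      eqrM (e * v * t) 1 (pc_dh pc) &+ eqrM e d pc_vl)).
  ncr.
apply: (eqr_comb (eqrM 1 v E &+ eqrM (- (e * v * (d + t))) 1 pc_vr &+
    eqrM e (e * v) (esym pc_tu) &+ eqrM (- (e * t * u)) v (pc_ee pc) &+
    eqrM (-1) v (pc_de pc))); ncr.
Qed.

(** Becomes the formula for the differential of h'. Since (1 - ht)uh = h = uh(1 - th), multiplying
    by 1 - ht on the left and by 1 - th on the right removes the inverses. *)
Lemma pc_d_uh : (d + t) * (u * h) + u * h * (d + t) = u * e * (e * v) - 1.
Proof.
have E : (1 - h * t) * ((d + t) * (u * h) + u * h * (d + t)) * (1 - t * h) =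
         e - (1 - h * t) * (1 - t * h).
  apply: (eqr_comb (eqrM ((1 - h * t) * (d + t)) (1 - t * h) (esym pc_hv) &+
      eqrM ((1 - h * t) * (d + t) * h) 1 pc_vl &+
      eqrM 1 (h * (d + t) * (1 - t * h)) (pc_ur pc) &+ pc_dh pc &+
      eqrM (- h) h (pc_dt pc))); ncr.
have := congr1 (fun x => u * x * v) E.
have -> : forall z, u * ((1 - h * t) * z * (1 - t * h)) * v = z.
  move=> z; apply: (eqr_comb (eqrM 1 (z * (1 - t * h) * v) (pc_ul pc) &+
      eqrM z 1 pc_vr)); ncr.
move=> ->; apply: (eqr_comb (eqrM (- u) v (pc_ee pc) &+
    eqrM (-1) ((1 - t * h) * v) (pc_ul pc) &+ eqrM (-1) 1 pc_vr)); ncr.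
Qed.

(** Becomes the perturbation equation of t'. It combines [pc_d_ue], multiplied by et on the left,
    with the equation of t between e and ue. *)
Lemma pc_dt_ue :
  d * (e * t * (u * e)) + e * t * (u * e) * d
  + e * t * (u * e) * (e * t * (u * e)) = 0.
Proof.
apply: (eqr_comb (eqrM 1 (t * (u * e)) (pc_de pc) &+
    eqrM e (u * e) (pc_dt pc) &+ eqrM (- (e * t)) 1 pc_d_ue &+
    eqrM (e * t * u) (t * u * e) (pc_ee pc))).
ncr.
Qed.

End PerturbationLemma.

End NoncommutativeRing.

(* Tensor products of perturbed contractions *)
#[local] Existing Instances pzRing_ops pzRing_ring.
#[local] Notation "H &+ K" := (eqrD H K) (at level 50, left associativity).

(* [L a * M b] plays the role of the tensor product of a and b, without sign;
   the Koszul sign is carried by the grading involution s. *)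
Section TensorPerturbation.
Variables (Rp Rq R : pzRingType).
Variables (L : {rmorphism Rp -> R}) (M : {rmorphism Rq -> R}).
Hypothesis LM : forall a b, L a * M b = M b * L a.
(** The indices p and q mark maps on the two tensor factors. The elements [h] and [u] live on the
    whole product and are not given by a formula in those of the factors; [h] is tied to them only
    through [pcpq], [pseudol] and [pseudor]. *)
Variables (s dp tp hp e_p up : Rp) (dq tq hq e_q uq : Rq) (h u : R).
Let odd b := L s * M b.
Hypotheses (ss : s * s = 1) (se : s * e_p = e_p * s) (sd : s * dp = - (dp * s))
  (st : s * tp = - (tp * s)) (sh : s * hp = - (hp * s)).
Hypotheses (pcp : perturbed_contraction dp tp hp e_p up)
  (pcq : perturbed_contraction dq tq hq e_q uq)
  (pcpq : perturbed_contraction (L dp + odd dq) (L tp + odd tq) h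
    (L e_p * M e_q) u).
Hypotheses
  (pseudol : (L hp - odd hq) * h = L hp * odd hq)
  (pseudor : h * (L hp - odd hq) = - (L hp * odd hq)).
Let vp := 1 + tp * up * hp.
Let vq := 1 + tq * uq * hq.

(** Both h and t anticommute with s, so 1 - ht commutes with s, and so does its inverse. *)
Let su : s * up = up * s.
Proof.
apply: (eqr_comb (eqrM (-1) (s * up) (pc_ul pcp) &+
    eqrM (up * s) 1 (pc_ur pcp) &+ eqrM up (tp * up) sh &+
    eqrM (- (up * hp)) up st)); ncr.
Qed.

Let comm_odd a b : s * a = a * s -> L a * odd b = odd b * L a.
Proof. by move=> sa; rewrite /odd -mulrA -LM !mulrA -!rmorphM /= sa. Qed.

Let anti a b : s * a = - (a * s) -> L a * odd b = - (odd b * L a).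
Proof.
move=> sa; rewrite /odd -[in RHS]mulrA -LM !mulrA -!rmorphM /= sa rmorphN.
by rewrite !mulNr opprK.
Qed.

Let odd_odd a b : odd a * odd b = M (a * b).
Proof.
by rewrite /odd -mulrA [M a * _]mulrA -LM -!mulrA -rmorphM !mulrA -rmorphM ss
  rmorph1 mul1r.
Qed.

Let even_odd a b : M a * odd b = odd (a * b).
Proof. by rewrite /odd mulrA -LM -mulrA -rmorphM. Qed.

Let odd_even a b : odd a * M b = odd (a * b).
Proof. by rewrite /odd -mulrA -rmorphM. Qed.

Let odd0 : odd 0 = 0.
Proof. by rewrite /odd rmorph0 mulr0. Qed.

(* The differentials of [pseudol] and [pseudor]. *)
Let boundary_pseudol :
  L e_p * h - M e_q * h = L e_p * odd hq - L hp * M e_q.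
Proof.
have dp_hp : L dp * L hp + L hp * L dp = L e_p - 1.
  by rewrite -!rmorphM -rmorphD (pc_dh pcp) rmorphB rmorph1.
have dq_hq : odd dq * odd hq + odd hq * odd dq = M e_q - 1.
  by rewrite !odd_odd -rmorphD (pc_dh pcq) rmorphB rmorph1.
have he1 : L hp * L e_p = 0 by rewrite -rmorphM (pc_he pcp) rmorph0.
have he2 : odd hq * M e_q = 0 by rewrite odd_even (pc_he pcq) odd0.
have A1 := anti hq sd; have A2 := anti dq sh.
have C := LM e_p e_q.
(* The first two terms form the commutator of the relation with the total differential; the relation
   has degree 2, so no sign arises. The other terms evaluate this commutator. *)
apply: (eqr_comb (eqrM (L dp + odd dq) 1 pseudol &+
    eqrM (-1) (L dp + odd dq) pseudol &+ eqrM (-1) (h - odd hq) dp_hp &+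
    eqrM (-1) (h - odd hq) A2 &+ eqrM 1 h A1 &+ eqrM 1 h dq_hq &+
    eqrM (L hp - odd hq) 1 (pc_dh pcpq) &+ eqrM (- L hp) 1 A1 &+
    eqrM (- L hp) 1 dq_hq &+ eqrM 1 (M e_q) he1 &+ eqrM (-1) (L e_p) he2 &+
    eqrM (- odd hq) 1 C)); ncr.
Qed.

Let boundary_pseudor :
  h * L e_p - h * M e_q = L e_p * odd hq - L hp * M e_q.
Proof.
have dp_hp : L dp * L hp + L hp * L dp = L e_p - 1.
  by rewrite -!rmorphM -rmorphD (pc_dh pcp) rmorphB rmorph1.
have dq_hq : odd dq * odd hq + odd hq * odd dq = M e_q - 1.
  by rewrite !odd_odd -rmorphD (pc_dh pcq) rmorphB rmorph1.
have eh1 : L e_p * L hp = 0 by rewrite -rmorphM (pc_eh pcp) rmorph0.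
have eh2 : M e_q * odd hq = 0 by rewrite even_odd (pc_eh pcq) odd0.
have A1 := anti hq sd; have A2 := anti dq sh.
have C : M e_q * L hp = L hp * M e_q by rewrite LM.
apply: (eqr_comb (eqrM 1 (L dp + odd dq) pseudor &+
    eqrM (- (L dp + odd dq)) 1 pseudor &+
    eqrM 1 (L hp - odd hq) (pc_dh pcpq) &+ eqrM (- h) 1 dp_hp &+
    eqrM h 1 dq_hq &+ eqrM (- h) 1 A2 &+ eqrM h 1 A1 &+
    eqrM 1 (odd hq) dp_hp &+ eqrM (- L hp) 1 A1 &+ eqrM 1 (odd hq) A2 &+
    eqrM (- L hp) 1 dq_hq &+ eqrM (L e_p) 1 C &+ eqrM 1 (M e_q) eh1 &+
    eqrM (- L e_p) 1 eh2)); ncr.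
Qed.

(** Multiplying [boundary_pseudol] by e ⊗ 1 on the left kills the terms with eh and with (e ⊗ e)h.
    The next three identities arise likewise, on either side, from e ⊗ 1 or 1 ⊗ e. *)
Let ep_h : L e_p * h = L e_p * odd hq.
Proof.
have e1e1 : L e_p * L e_p = L e_p by rewrite -rmorphM (pc_ee pcp).
have eh1 : L e_p * L hp = 0 by rewrite -rmorphM (pc_eh pcp) rmorph0.
apply: (eqr_comb (eqrM (L e_p) 1 boundary_pseudol &+ eqrM (-1) h e1e1 &+
    eqrM 1 (odd hq) e1e1 &+ eqrM (-1) (M e_q) eh1 &+ eqrM 1 1 (pc_eh pcpq))); ncr.
Qed.

Let eq_h : M e_q * h = L hp * M e_q.
Proof.
have e2e2 : M e_q * M e_q = M e_q by rewrite -rmorphM (pc_ee pcq).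
have eh2 : M e_q * odd hq = 0 by rewrite even_odd (pc_eh pcq) odd0.
have C := LM e_p e_q; have C' := LM hp e_q.
apply: (eqr_comb (eqrM (- M e_q) 1 boundary_pseudol &+ eqrM (-1) h e2e2 &+
    eqrM (-1) h C &+ eqrM 1 (odd hq) C &+ eqrM (- L e_p) 1 eh2 &+
    eqrM (-1) (M e_q) C' &+ eqrM (L hp) 1 e2e2 &+ eqrM 1 1 (pc_eh pcpq))); ncr.
Qed.

Let h_ep : h * L e_p = L e_p * odd hq.
Proof.
have e1e1 : L e_p * L e_p = L e_p by rewrite -rmorphM (pc_ee pcp).
have he1 : L hp * L e_p = 0 by rewrite -rmorphM (pc_he pcp) rmorph0.
have C := LM e_p e_q; have C' := comm_odd hq se.
apply: (eqr_comb (eqrM 1 (L e_p) boundary_pseudor &+ eqrM (- h) 1 e1e1 &+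
    eqrM (- h) 1 C &+ eqrM 1 1 (pc_he pcpq) &+ eqrM (- L e_p) 1 C' &+
    eqrM 1 (odd hq) e1e1 &+ eqrM (L hp) 1 C &+ eqrM (-1) (M e_q) he1)); ncr.
Qed.

Let h_eq : h * M e_q = L hp * M e_q.
Proof.
have e2e2 : M e_q * M e_q = M e_q by rewrite -rmorphM (pc_ee pcq).
have he2 : odd hq * M e_q = 0 by rewrite odd_even (pc_he pcq) odd0.
apply: (eqr_comb (eqrM (-1) (M e_q) boundary_pseudor &+ eqrM (- h) 1 e2e2 &+
    eqrM 1 1 (pc_he pcpq) &+ eqrM (L hp) 1 e2e2 &+ eqrM (- L e_p) 1 he2)); ncr.
Qed.

(** Right multiplication by 1 - (t ⊗ 1 + 1 ⊗ t)h takes both sides to e ⊗ e, and its right inverse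
    leads back. *)
Lemma tensor_ev : L e_p * M e_q * (1 + (L tp + odd tq) * u * h) =
  L (e_p * vp) * M (e_q * vq).
Proof.
pose t1 := L tp; pose p1 := L (e_p * vp); pose p2 := M (e_q * vq).
pose q2 := odd (e_q * vq * tq).
(* This is ev(1 - th) = e in the left factor; [G2] is the same in the right factor. *)
have F1 : p1 * t1 * L hp = p1 - L e_p.
  rewrite -!rmorphM -rmorphB; congr (L _).
  by apply: (eqr_comb (eqrM (- e_p) 1 (pc_vl pcp))); rewrite /vp; ncr.
have G2 : q2 * odd hq = p2 - M e_q.
  rewrite odd_odd -rmorphB; congr (M _).
  by apply: (eqr_comb (eqrM (- e_q) 1 (pc_vl pcq))); rewrite /vq; ncr.
have Q : p2 * odd tq = q2 by rewrite even_odd.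
have c1 : p2 * t1 = t1 * p2 by rewrite LM.
have c2 : L e_p * q2 = q2 * L e_p by apply: comm_odd.
have c3 : L hp * q2 = - (q2 * L hp) by apply: anti.
have c4 : L e_p * odd hq = odd hq * L e_p by apply: comm_odd.
have c5 : L e_p * p2 = p2 * L e_p by apply: LM.
have c6 : L e_p * M e_q = M e_q * L e_p by apply: LM.
(* In the summand with [t1] the factor [p2] is expanded by [G2], in the one with [odd tq] the factor
   [p1] by [F1]. Terms containing e are settled by [eq_h] and [ep_h]; the others combine to a
   multiple of (h ⊗ 1 - 1 ⊗ h)h, where [pseudol] applies. *)
have E : p1 * p2 * (1 - (t1 + odd tq) * h) = L e_p * M e_q.
  apply: (eqr_comb (eqrM (- p1) h c1 &+ eqrM (p1 * t1) h G2 &+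
      eqrM (- p1 * t1) 1 eq_h &+ eqrM (-1) (M e_q) F1 &+ eqrM (- p1) h Q &+
      eqrM 1 (q2 * h) F1 &+ eqrM (-1) h c2 &+ eqrM (- q2) 1 ep_h &+
      eqrM (- q2) 1 c4 &+ eqrM (-1) (L e_p) G2 &+ eqrM (- p1 * t1) h c3 &+
      eqrM (p1 * t1 * q2) 1 pseudol &+ eqrM (p1 * t1) (odd hq) c3 &+
      eqrM (-1) (q2 * odd hq) F1 &+ eqrM (- (p1 - L e_p)) 1 G2 &+
      eqrM 1 1 c5 &+ eqrM (-1) 1 c6)); ncr.
by apply: (eqr_comb (eqrM (-1) (1 + (L tp + odd tq) * u * h) E &+
    eqrM (p1 * p2) 1 (pc_vr pcpq))); ncr.
Qed.

(** Mirror image of [tensor_ev]: the factor 1 - h(t ⊗ 1 + 1 ⊗ t) is multiplied on the left, and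
    [h_ep], [h_eq] and [pseudor] take over. *)
Lemma tensor_ue : u * (L e_p * M e_q) = L (up * e_p) * M (uq * e_q).
Proof.
pose t1 := L tp; pose w1 := L (up * e_p); pose w2 := M (uq * e_q).
pose r1 := L (tp * (up * e_p)); pose q2 := odd (tq * (uq * e_q)).
have F1 : L hp * r1 = w1 - L e_p.
  rewrite -!rmorphM -rmorphB; congr (L _).
  by apply: (eqr_comb (eqrM (-1) e_p (pc_ur pcp))); ncr.
have G2 : odd hq * q2 = w2 - M e_q.
  rewrite odd_odd -rmorphB; congr (M _).
  by apply: (eqr_comb (eqrM (-1) e_q (pc_ur pcq))); ncr.
have Q : odd tq * w2 = q2 by rewrite odd_even.
have Q1 : t1 * w1 = r1 by rewrite -rmorphM.
have c1 : r1 * w2 = w2 * r1 by rewrite LM.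
have sue : s * (up * e_p) = up * e_p * s by rewrite mulrA su -!mulrA se.
have sr : s * (tp * (up * e_p)) = - (tp * (up * e_p) * s).
  by rewrite mulrA st mulNr -[tp * s * _]mulrA sue !mulrA.
have c2 : w1 * odd tq = odd tq * w1 by apply: comm_odd.
have c3 : r1 * q2 = - (q2 * r1) by apply: anti.
have c7 : r1 * M e_q = M e_q * r1 by apply: LM.
have c8 : r1 * odd hq = - (odd hq * r1) by apply: anti.
have E : (1 - h * (t1 + odd tq)) * (w1 * w2) = L e_p * M e_q.
  apply: (eqr_comb (eqrM (- h) w2 Q1 &+ eqrM (- h) 1 c1 &+ eqrM h r1 G2 &+
      eqrM (-1) r1 h_eq &+ eqrM (L hp) 1 c7 &+ eqrM (-1) (M e_q) F1 &+
      eqrM h w2 c2 &+ eqrM (- h * w1) 1 Q &+ eqrM h q2 F1 &+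
      eqrM (-1) q2 h_ep &+ eqrM (- L e_p) 1 G2 &+ eqrM (- h * odd hq) 1 c3 &+
      eqrM (-1) (r1 * q2) pseudor &+ eqrM (L hp) q2 c8 &+
      eqrM (-1) (odd hq * q2) F1 &+ eqrM (- (w1 - L e_p)) 1 G2)); ncr.
by apply: (eqr_comb (eqrM (- u) 1 E &+ eqrM 1 (w1 * w2) (pc_ul pcpq))); ncr.
Qed.

Lemma tensor_pseudo_derivationl :
  (L (up * hp) - odd (uq * hq)) * (u * h) = L (up * hp) * odd (uq * hq).
Proof.
pose U1 := L up; pose h1 := L hp; pose t1 := L tp; pose y2 := odd (uq * hq).
pose U2 := M uq; pose h2 := odd hq; pose t2 := odd tq.
have -> : L (up * hp) = U1 * h1 by rewrite rmorphM.
rewrite -/y2.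
have Y : y2 = U2 * h2 by rewrite even_odd.
have F1 : U1 * h1 * t1 = U1 - 1.
  rewrite -!rmorphM -[1](rmorph1 L) -rmorphB; congr (L _).
  by apply: (eqr_comb (eqrM (-1) 1 (pc_ul pcp))); ncr.
have F2 : y2 * t2 = U2 - 1.
  rewrite odd_odd -[1](rmorph1 M) -rmorphB; congr (M _).
  by apply: (eqr_comb (eqrM (-1) 1 (pc_ul pcq))); ncr.
have c1 : t1 * y2 = - (y2 * t1) by apply: anti.
have c2 : h1 * U2 = U2 * h1 by apply: LM.
(* When the right side is expanded by [F1] and [F2], the terms absent from the left side form u ⊗ u
   times the difference of the two sides of [pseudol]. *)
have E : (U1 * h1 - y2) * h = U1 * h1 * y2 * (1 - (t1 + t2) * h).
  apply: (eqr_comb (eqrM (U1 * h1) h c1 &+ eqrM (-1) (y2 * h) F1 &+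
      eqrM (U1 * h1) h F2 &+ eqrM U1 h c2 &+ eqrM (- U1) h Y &+
      eqrM (U1 * U2) 1 pseudol &+ eqrM (- U1) h2 c2 &+ eqrM (- U1 * h1) 1 Y)); ncr.
(* As uh = hv, multiplying [E] by v on the right gives the claim. *)
have H := pc_hv pcpq; rewrite -H.
by apply: (eqr_comb (eqrM 1 (1 + (t1 + t2) * u * h) E &+
    eqrM (U1 * h1 * y2) 1 (pc_vr pcpq))); ncr.
Qed.

Lemma tensor_pseudo_derivationr :
  u * h * (L (up * hp) - odd (uq * hq)) = - (L (up * hp) * odd (uq * hq)).
Proof.
(* With hv in place of uh the inverses of the factors move to the right, so that [pseudor] can be
   used with v ⊗ v behind it. *)
rewrite -(pc_hv pcp) -(pc_hv pcq) -/vp -/vq.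
pose V1 := L vp; pose h1 := L hp; pose t1 := L tp; pose y2 := odd (hq * vq).
pose V2 := M vq; pose h2 := odd hq; pose t2 := odd tq.
have -> : L (hp * vp) = h1 * V1 by rewrite rmorphM.
rewrite -/y2.
have Y : y2 = h2 * V2 by rewrite odd_even.
have F1 : t1 * (h1 * V1) = V1 - 1.
  rewrite -!rmorphM -[1](rmorph1 L) -rmorphB; congr (L _).
  by apply: (eqr_comb (eqrM (-1) 1 (pc_vr pcp))); rewrite /vp; ncr.
have F2 : t2 * y2 = V2 - 1.
  rewrite odd_odd -[1](rmorph1 M) -rmorphB; congr (M _).
  by apply: (eqr_comb (eqrM (-1) 1 (pc_vr pcq))); rewrite /vq; ncr.
have sv : s * vp = vp * s.
  rewrite /vp mulrDr mulrDl mulr1 mul1r !mulrA st !mulNr -[tp * s * up]mulrA su.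
  by rewrite mulrA -[_ * s * hp]mulrA sh mulrN opprK mulrA.
have shv : s * (hp * vp) = - (hp * vp * s).
  by rewrite mulrA sh mulNr -[hp * s * _]mulrA sv mulrA.
have c1 : h1 * V1 * t2 = - (t2 * (h1 * V1)).
  by rewrite -rmorphM; apply: anti.
have c2 : V1 * h2 = h2 * V1 by apply: comm_odd.
have E : h * (h1 * V1 - y2) = - ((1 - h * (t1 + t2)) * (h1 * V1 * y2)).
  apply: (eqr_comb (eqrM (- h) y2 F1 &+ eqrM (- h) y2 c1 &+
      eqrM (h * h1 * V1) 1 F2 &+ eqrM (- h * V1) 1 Y &+ eqrM (- h) V2 c2 &+
      eqrM 1 (V1 * V2) pseudor &+ eqrM (h1 * V1) 1 Y &+ eqrM h1 V2 c2)); ncr.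
by apply: (eqr_comb (eqrM u 1 E &+ eqrM (-1) (h1 * V1 * y2) (pc_ul pcpq))); ncr.
Qed.

End TensorPerturbation.

(** * Linear maps and homogeneous tensors *)

Section LinearMaps.
Variables (k : comPzRingType) (U V : lmodType k) (F : U -> V).
Hypothesis linF : linear F.
Lemma lin0 : F 0 = 0.
Proof. by have := linF (-1) 0 0; rewrite !scaleN1r oppr0 add0r addNr. Qed.
Lemma linD x y : F (x + y) = F x + F y.
Proof. by have := linF 1 x y; rewrite !scale1r. Qed.
Lemma linZ c x : F (c *: x) = c *: F x.
Proof. by have := linF c x 0; rewrite lin0 !addr0. Qed.
Lemma linN x : F (- x) = - F x.
Proof. by rewrite -scaleN1r linZ scaleN1r. Qed.
Lemma linB x y : F (x - y) = F x - F y.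
Proof. by rewrite linD linN. Qed.
Lemma lin_sum (I : Type) (r : seq I) (x : I -> U) :
  F (\sum_(i <- r) x i) = \sum_(i <- r) F (x i).
Proof. by elim: r => [|i r IH]; rewrite ?big_nil ?lin0 // !big_cons linD IH. Qed.
End LinearMaps.

Lemma lin_comp (k : comPzRingType) (U V W : lmodType k) (F : V -> W)
    (G : U -> V) :
  linear F -> linear G -> linear (fun x => F (G x)).
Proof. by move=> linF linG c x y; rewrite linG linF. Qed.

Lemma lin_add (k : comPzRingType) (U V : lmodType k) (F G : U -> V) :
  linear F -> linear G -> linear (fun x => F x + G x).
Proof. by move=> linF linG c x y; rewrite linF linG scalerDr addrACA. Qed.

Lemma lin_scale (k : comPzRingType) (U V : lmodType k) (F : U -> V) c :
  linear F -> linear (fun x => c *: F x).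
Proof. by move=> linF b x y; rewrite linF scalerDr !scalerA mulrC. Qed.

Lemma lin_opp (k : comPzRingType) (U V : lmodType k) (F : U -> V) :
  linear F -> linear (fun x => - F x).
Proof. by move=> linF b x y; rewrite linF opprD scalerN. Qed.

Section Homogeneous.
Variable k : comPzRingType.
Implicit Types A B : gmod k.

Lemma ksgnD (i j : int) : ksgn k (i + j) = ksgn k i * ksgn k j.
Proof.
rewrite !ksgn_odd.
have -> : odd (absz (i + j)) = odd (absz i) (+) odd (absz j) by lia.
by case: (odd (absz i)); case: (odd (absz j)); rewrite /= ?mulrNN ?mulr1 ?mul1r.
Qed.

Lemma upd_id (A : lmodType k) n (a : {ffun 'I_n -> A}) j : upd a j (a j) = a.
Proof. by apply/ffunP => i; rewrite ffunE; case: eqP => [->|]. Qed.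

Lemma upd_linear (A : lmodType k) n (P : lmodType k) (F : TP A n -> P) a j :
  linear F -> linear (fun x => F (pure (upd a j x))).
Proof. by move=> linF c x y; rewrite pure_multilinear linF. Qed.

Lemma gpr_decomp A (a : A) : exists r : seq int, a = \sum_(i <- r) gpr i a.
Proof.
have [r [ur Hr]] := gpr_supp a a; exists r.
rewrite [LHS]gpr_sum (bigfs _ ur) => [|i _]; last first.
  by apply: contraNeq => /(proj1 (Hr i)).
by congr bigop; congr finite_support; apply/seteqP.
Qed.

(** Tensors of homogeneous elements span, each factor being a finite sum of its homogeneous
    components. *)
Lemma tp_hmg_ext A n (P : lmodType k) (F G : TP A n -> P) :
  linear F -> linear G ->
  (forall (a : {ffun 'I_n -> A}) (deg : 'I_n -> int),
     (forall j, hmg (deg j) (a j)) -> F (pure a) = G (pure a)) ->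
  F =1 G.
Proof.
move=> linF linG FG; apply: tp_ext => // a.
(* The list [s] holds the positions whose factor need not be homogeneous; the induction splits these
   factors one at a time. *)
suff H (s : seq 'I_n) : forall a : {ffun 'I_n -> A},
    (forall j, j \notin s -> exists i, hmg i (a j)) -> F (pure a) = G (pure a).
  by apply: (H (enum 'I_n)) => j; rewrite mem_enum.
elim: s => [|j s IH] {}a Ha.
  have /choice[deg Hdeg] : forall j, exists i, hmg i (a j) by move=> j; apply: Ha.
  exact: FG Hdeg.
rewrite -(upd_id a j); have [r ->] := gpr_decomp (a j).
rewrite (lin_sum (upd_linear a j linF)) (lin_sum (upd_linear a j linG)).
apply: eq_bigr => i _; apply: IH => l ls; rewrite ffunE; case: eqP => [_|/eqP lj].
  by exists i; rewrite /hmg gpr_gpr eqxx.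
by apply: Ha; rewrite inE negb_or lj.
Qed.

Lemma pure_scale (A : lmodType k) n (c : 'I_n -> k) (a : {ffun 'I_n -> A}) :
  pure [ffun j => c j *: a j] = (\prod_j c j) *: pure a.
Proof.
(* Scalars are pulled out one position at a time; [s] lists the positions that carry one. *)
suff H (s : seq 'I_n) : uniq s ->
    pure [ffun j => if j \in s then c j *: a j else a j] =
    (\prod_(j <- s) c j) *: pure a.
  rewrite -(H _ (index_enum_uniq _)); congr pure; apply/ffunP => j.
  by rewrite !ffunE mem_index_enum.
elim: s => [_|j s IH /= /andP[js us]].
  by rewrite big_nil scale1r; congr pure; apply/ffunP => j; rewrite ffunE.
rewrite big_cons -scalerA -IH //; set b := [ffun=> _].
have E := linZ (upd_linear b j (F := id) (fun _ _ _ => erefl)) (c j) (b j).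
rewrite upd_id in E; rewrite -E; congr pure; apply/ffunP => i.
by rewrite !ffunE inE; case: eqP => [->|]; rewrite ?(negbTE js).
Qed.

Lemma teps_hmg A n e m (x : TP A n) : thmg m x -> teps e x = ksgn k (e * m) *: x.
Proof.
move=> [s [-> Hs]]; rewrite (lin_sum (@teps_linear k A n e)) scaler_sumr.
apply: eq_big_seq => u /Hs[deg [<- Hdeg]].
rewrite (linZ (@teps_linear k A n e)) teps_pure.
have -> : [ffun j => geps e (u.2 j)] = [ffun j => ksgn k (e * deg j) *: u.2 j].
  by apply/ffunP => j; rewrite !ffunE (geps_hmg _ (Hdeg j)).
rewrite pure_scale !scalerA mulrC; congr (_ * _ *: _).
rewrite mulr_sumr; apply: (big_rec2 (fun x y => x = ksgn k y)) => [|i y1 y2 _ ->].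
  by rewrite ksgn_odd.
by rewrite ksgnD.
Qed.

Lemma thmg_pure A n (deg : 'I_n -> int) (a : {ffun 'I_n -> A}) :
  (forall j, hmg (deg j) (a j)) -> thmg (\sum_j deg j) (pure a).
Proof.
move=> Ha; exists [:: (1, a)]; rewrite big_seq1 scale1r; split=> // u.
by rewrite inE => /eqP ->; exists deg.
Qed.

Lemma thmgD A n m (x y : TP A n) : thmg m x -> thmg m y -> thmg m (x + y).
Proof.
move=> [s [-> Hs]] [r [-> Hr]]; exists (s ++ r); rewrite big_cat; split=> // u.
by rewrite mem_cat => /orP[/Hs|/Hr].
Qed.

Lemma thmgZ A n m c (x : TP A n) : thmg m x -> thmg m (c *: x).
Proof.
move=> [s [-> Hs]]; exists [seq (c * u.1, u.2) | u <- s].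
rewrite big_map scaler_sumr; split=> [|_ /mapP[u /Hs Hu ->] //].
by apply: eq_bigr => u _; rewrite scalerA.
Qed.

Lemma thmg0 A n m : thmg m (0 : TP A n).
Proof. by exists [::]; rewrite big_nil; split. Qed.

Lemma thmg_sum A n m (I : Type) (r : seq I) (x : I -> TP A n) :
  (forall i, thmg m (x i)) -> thmg m (\sum_(i <- r) x i).
Proof. by move=> Hx; apply: big_ind => //; [exact: thmg0|exact: thmgD]. Qed.

Lemma thmg_lin A B n p m e (F : TP A n -> TP B p) : linear F ->
  (forall (a : {ffun 'I_n -> A}) (deg : 'I_n -> int),
    (forall j, hmg (deg j) (a j)) -> thmg (\sum_j deg j + e) (F (pure a))) ->
  forall x, thmg m x -> thmg (m + e) (F x).
Proof.
move=> linF HF _ [s [-> Hs]]; rewrite (lin_sum linF) big_seq.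
apply: big_ind; [exact: thmg0|exact: thmgD|move=> u /Hs[deg [<- Hdeg]]].
by rewrite (linZ linF); apply: thmgZ; apply: HF.
Qed.

Lemma thick_teps A B n e c (F : TP A n -> TP B n) :
  linear F -> (forall m x, thmg m x -> thmg (m + e) (F x)) ->
  forall x, teps c (F x) = ksgn k (c * e) *: F (teps c x).
Proof.
move=> linF HF; apply: tp_hmg_ext => [||a deg Ha].
- exact: lin_comp (@teps_linear _ _ _ _) linF.
- exact/lin_scale/(lin_comp linF (@teps_linear _ _ _ _)).
have Hp := thmg_pure Ha.
rewrite (teps_hmg _ Hp) (teps_hmg _ (HF _ _ Hp)) (linZ linF) scalerA.
by rewrite mulrDr ksgnD mulrC.
Qed.

Lemma geps_even A e (a : A) : odd (absz e) = false -> geps e a = a.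
Proof. by move=> He; rewrite /geps ksgn_odd He scale1r -gpar_sum. Qed.

Lemma teps_even A n e (x : TP A n) : odd (absz e) = false -> teps e x = x.
Proof.
move=> He; apply: (tp_ext (F := teps e) (G := id)) x => //.
  exact: teps_linear.
move=> a; rewrite teps_pure; congr pure; apply/ffunP => j.
by rewrite ffunE geps_even.
Qed.

Lemma tepsD A n c e (x : TP A n) : teps c (teps e x) = teps (c + e) x.
Proof.
apply: (tp_hmg_ext (F := fun x => teps c (teps e x)) (G := teps (c + e))) x.
- exact: lin_comp (@teps_linear _ _ _ _) (@teps_linear _ _ _ _).
- exact: teps_linear.
move=> a deg Ha; have Hp := thmg_pure Ha.
rewrite !(teps_hmg _ Hp) (linZ (@teps_linear _ _ _ _)) (teps_hmg _ Hp) scalerA.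
by rewrite mulrDl ksgnD mulrC.
Qed.

(** The sign depends only on the parity of the degree, so -1 may be shifted by 2. *)
Lemma tepsN1 A n (x : TP A n) : teps (-1) x = teps 1 x.
Proof. by rewrite -[LHS](@teps_even A n 2) // tepsD. Qed.

End Homogeneous.

(** * Endomorphism rings of tensor powers *)

Section LinearEndomorphisms.
Variables (k : comPzRingType) (U : lmodType k).

(** Linear endomorphisms are bundled so that they form a ring under composition, where the ring
    identities above apply. The module may be zero, so 1 = 0 has to be allowed. *)
Record lend := Lend { lend_fun :> U -> U; lendP : linear lend_fun }.

Lemma lend_ext (F G : lend) : F =1 G -> F = G.
Proof.
case: F G => [F linF] [G linG] /= /funext FG; rewrite {}FG in linF *.
by congr Lend; exact: Prop_irrelevance.
Qed.

HB.instance Definition _ := gen_eqMixin lend.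
HB.instance Definition _ := gen_choiceMixin lend.

Fact id_linear : linear (@id U). Proof. by []. Qed.
Fact zero_linear : linear (fun _ : U => 0 : U).
Proof. by move=> c x y; rewrite scaler0 addr0. Qed.

Definition lend_zero := Lend zero_linear.
Definition lend_one := Lend id_linear.
Definition lend_add F G := Lend (lin_add (lendP F) (lendP G)).
Definition lend_opp F := Lend (lin_opp (lendP F)).
Definition lend_mul F G := Lend (lin_comp (lendP F) (lendP G)).

Fact lend_addA : associative lend_add.
Proof. by move=> F G H; apply: lend_ext => x /=; rewrite addrA. Qed.
Fact lend_addC : commutative lend_add.
Proof. by move=> F G; apply: lend_ext => x /=; rewrite addrC. Qed.
Fact lend_add0 : left_id lend_zero lend_add.
Proof. by move=> F; apply: lend_ext => x /=; rewrite add0r. Qed.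
Fact lend_addN : left_inverse lend_zero lend_opp lend_add.
Proof. by move=> F; apply: lend_ext => x /=; rewrite addNr. Qed.

HB.instance Definition _ :=
  GRing.isZmodule.Build lend lend_addA lend_addC lend_add0 lend_addN.

Fact lend_mulA : associative lend_mul.
Proof. by move=> F G H; apply: lend_ext. Qed.
Fact lend_mul1 : left_id lend_one lend_mul.
Proof. by move=> F; apply: lend_ext. Qed.
Fact lend_mulr1 : right_id lend_one lend_mul.
Proof. by move=> F; apply: lend_ext. Qed.
Fact lend_mulDl : left_distributive lend_mul lend_add.
Proof. by move=> F G H; apply: lend_ext. Qed.
Fact lend_mulDr : right_distributive lend_mul lend_add.
Proof. by move=> F G H; apply: lend_ext => x /=; rewrite (linD (lendP F)). Qed.

HB.instance Definition _ := GRing.Zmodule_isPzRing.Build lend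
  lend_mulA lend_mul1 lend_mulr1 lend_mulDl lend_mulDr.

Lemma lendBE (F G : lend) x : (F - G) x = F x - G x. Proof. by []. Qed.
Lemma lendME (F G : lend) x : (F * G) x = F (G x). Proof. by []. Qed.

End LinearEndomorphisms.

(** * Tensor products of linear maps *)

Section TensorProducts.
Variable k : comPzRingType.
Implicit Types A B C : gmod k.

Lemma fcatK (A : gmod k) p q (a : {ffun 'I_(p + q) -> A}) :
  fcat [ffun j => a (lshift q j)] [ffun j => a (rshift p j)] = a.
Proof.
apply/ffunP => i; rewrite ffunE.
by case: (fintype.split_ordP i) => j ->; rewrite ?unsplitK ffunE.
Qed.

Lemma tcat_ext A p q (P : lmodType k) (F G : TP A (p + q) -> P) :
  linear F -> linear G -> (forall u v, F (tcat u v) = G (tcat u v)) -> F =1 G.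
Proof.
move=> linF linG FG; apply: tp_ext => // a.
by rewrite -[a](fcatK a) -tcat_pure FG.
Qed.

Section Tens.
Variables (A B : gmod k) (p q : nat).
Variables (F : TP A p -> TP B p) (G : TP A q -> TP B q).
Hypotheses (linF : linear F) (linG : linear G).

Lemma tens0_tcat u v : tens 0 F G (tcat u v) = tcat (F u) (G v).
Proof. by rewrite tens_tcat // teps_even. Qed.

(** Moving the Koszul sign into the left factor leaves the unsigned product [tens 0], which composes
    factor by factor. *)
Lemma tens_teps e x : tens e F G x = tens 0 (fun u => F (teps e u)) G x.
Proof.
have linE : linear (fun u => F (teps e u)) :=
  lin_comp linF (@teps_linear _ _ _ _).
apply: (tcat_ext (F := tens e F G)) x.
- exact: tens_linear.
- exact: tens_linear.
by move=> u v; rewrite !tens_tcat // [teps 0 u]teps_even.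
Qed.

End Tens.

Lemma tens0_comp A B C p q (F : TP B p -> TP C p) (G : TP B q -> TP C q)
    (F' : TP A p -> TP B p) (G' : TP A q -> TP B q) x :
  linear F -> linear G -> linear F' -> linear G' ->
  tens 0 F G (tens 0 F' G' x) = tens 0 (fun u => F (F' u)) (fun v => G (G' v)) x.
Proof.
move=> lF lG lF' lG'; have lFF := lin_comp lF lF'; have lGG := lin_comp lG lG'.
apply: (tcat_ext (F := fun x => tens 0 F G (tens 0 F' G' x))) x.
- by apply: lin_comp; exact: tens_linear.
- exact: tens_linear.
by move=> u v; rewrite !tens0_tcat.
Qed.

Lemma hmgZ A i c (a : A) : hmg i a -> hmg i (c *: a).
Proof. by rewrite /hmg (linZ (@gpr_linear _ A i)) => ->. Qed.

Lemma hmgD A i (a b : A) : hmg i a -> hmg i b -> hmg i (a + b).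
Proof. by rewrite /hmg (linD (@gpr_linear _ A i)) => -> ->. Qed.

Lemma hmg0 A i : hmg i (0 : A).
Proof. exact: (lin0 (@gpr_linear _ A i)). Qed.

Section Tdiff.
Variables (A : gmod k) (d : A -> A).

Lemma tdiff_linear n : linear d -> linear (@tdiff k A d n).
Proof. by move=> lind; apply/tlift_linear/tdiff_multilinear. Qed.

Lemma tdiff_thmg n m (x : TP A n) : linear d ->
  (forall i a, hmg i a -> hmg (i - 1) (d a)) ->
  thmg m x -> thmg (m - 1) (tdiff d x).
Proof.
move=> lind Hd; apply: thmg_lin => [|a deg Ha]; first exact: tdiff_linear.
rewrite tdiff_pure //; apply: thmg_sum => j.
have -> : \sum_j deg j - 1 = \sum_l (if l == j then deg l - 1 else deg l).
  rewrite (bigD1 j) //= [RHS](bigD1 j) //= eqxx addrAC; congr (_ + _).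
  by apply: eq_bigr => l /negbTE ->.
apply: thmg_pure => l; rewrite ffunE; case: ltnP => [lj|_].
  by rewrite -val_eqE (ltn_eqF lj) (geps_hmg _ (Ha l)); apply: hmgZ.
by case: eqP => [->|_] //; apply: Hd.
Qed.

(** The sum over positions splits into the first p and the last q; in the latter all p left factors
    carry the sign. The differential is thus a derivation of degree -1 and can be compared with
    t. *)
Lemma tdiff_tens p q (x : TP A (p + q)) : linear d ->
  tdiff d x = tens 0 (@tdiff _ _ d p) id x + tens (-1) id (@tdiff _ _ d q) x.
Proof.
move=> lind; have ld n := @tdiff_linear n lind.
apply: (tp_ext (F := @tdiff _ _ d _)
  (G := fun x => tens 0 (@tdiff _ _ d p) id x
                 + tens (-1) id (@tdiff _ _ d q) x)) x.
- exact: ld.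
- by apply: lin_add; exact: tens_linear.
move=> a; rewrite -[a](fcatK a); set b := [ffun _ => _]; set c := [ffun _ => _].
rewrite tdiff_pure // big_split_ord -tcat_pure /= tens0_tcat // tens_tcat //.
rewrite tepsN1 teps_pure !tdiff_pure //; congr (_ + _).
  rewrite (lin_sum (@tcat_linearl _ _ _ _ _)); apply: eq_bigr => j _.
  rewrite tcat_pure; congr pure; apply/ffunP => i; rewrite !ffunE.
  case: (fintype.split_ordP i) => l -> /=;
    rewrite ?(inj_eq (@lshift_inj _ _)) ?ffunE //.
  by rewrite ltnNge ltnW ?eq_rlshift // ltn_addr.
rewrite (lin_sum (@tcat_linearr _ _ _ _ _)); apply: eq_bigr => j _.
rewrite tcat_pure; congr pure; apply/ffunP => i; rewrite !ffunE.
case: (fintype.split_ordP i) => l -> /=; rewrite ?ffunE.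
  by rewrite ltn_addr.
by rewrite ltn_add2l (inj_eq (@rshift_inj _ _)).
Qed.

End Tdiff.

Section TensorRing.
Variables (A : gmod k) (p q : nat).

(** With [tensR] it plays the role of [L] and [M]: being free of signs, both are ring morphisms, and
    their images commute. *)
Definition tensL (F : lend (TP A p)) : lend (TP A (p + q)) :=
  Lend (tens_linear 0 (lendP F) (@id_linear _ _)).

Definition tensR (G : lend (TP A q)) : lend (TP A (p + q)) :=
  Lend (tens_linear 0 (@id_linear _ _) (lendP G)).

Lemma lend_tcat_ext (F G : lend (TP A (p + q))) :
  (forall u v, F (tcat u v) = G (tcat u v)) -> F = G.
Proof. by move=> FG; apply/lend_ext/tcat_ext => //; exact: lendP. Qed.

Lemma tensL_tcat F u v : tensL F (tcat u v) = tcat (F u) v.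
Proof. by rewrite /= tens0_tcat //; apply: lendP. Qed.

Lemma tensR_tcat G u v : tensR G (tcat u v) = tcat u (G v).
Proof. by rewrite /= tens0_tcat //; apply: lendP. Qed.

Fact tensL_zmod : zmod_morphism tensL.
Proof.
move=> F G; apply: lend_tcat_ext => u v.
rewrite lendBE !tensL_tcat lendBE.
by rewrite (linB (@tcat_linearl _ _ _ _ _)).
Qed.
Fact tensL_monoid : monoid_morphism tensL.
Proof.
split=> [|F G]; apply: lend_tcat_ext => u v; rewrite tensL_tcat //.
by rewrite !lendME !tensL_tcat.
Qed.
HB.instance Definition _ := GRing.isZmodMorphism.Build _ _ tensL tensL_zmod.
HB.instance Definition _ := GRing.isMonoidMorphism.Build _ _ tensL tensL_monoid.

Fact tensR_zmod : zmod_morphism tensR.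
Proof.
move=> F G; apply: lend_tcat_ext => u v.
rewrite lendBE !tensR_tcat lendBE.
by rewrite (linB (@tcat_linearr _ _ _ _ _)).
Qed.
Fact tensR_monoid : monoid_morphism tensR.
Proof.
split=> [|F G]; apply: lend_tcat_ext => u v; rewrite tensR_tcat //.
by rewrite !lendME !tensR_tcat.
Qed.
HB.instance Definition _ := GRing.isZmodMorphism.Build _ _ tensR tensR_zmod.
HB.instance Definition _ := GRing.isMonoidMorphism.Build _ _ tensR tensR_monoid.

Lemma tensLR F G : tensL F * tensR G = tensR G * tensL F.
Proof.
apply: lend_tcat_ext => u v.
by rewrite !lendME !(tensL_tcat, tensR_tcat).
Qed.

Lemma tens0E (F : lend (TP A p)) (G : lend (TP A q)) x :
  tens 0 F G x = (tensL F * tensR G) x.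
Proof. by rewrite /= tens0_comp //; exact: lendP. Qed.

(** Brings [tens 1] into the form [L F * odd G] of the ring computations, with [teps 1] as the
    grading involution. *)
Lemma tens1E (F : lend (TP A p)) (G : lend (TP A q)) x :
  tens 1 F G x = (tensL F * (tensL (Lend (@teps_linear k A p 1)) * tensR G)) x.
Proof.
rewrite tens_teps; [|exact: lendP..].
by rewrite mulrA -rmorphM -tens0E.
Qed.

End TensorRing.
End TensorProducts.

(** * Thick maps *)

Section ThickMaps.
Variable k : comPzRingType.
Implicit Types A B C : gmod k.

Lemma tmapP A B (f g : tmap A B) : (forall n x, f n x = g n x) -> f = g.
Proof. by move=> fg; apply: functional_extensionality_dep => n; apply/funext. Qed.

Lemma tmapE A B (f g : tmap A B) n x : f = g -> f n x = g n x.
Proof. by move->. Qed.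

Lemma thick_one A : is_thick 0 (@tm_one k A).
Proof. by move=> n; split=> // m x; rewrite addr0. Qed.

Lemma thick_comp A B C e c (f : tmap B C) (g : tmap A B) :
  is_thick e f -> is_thick c g -> is_thick (e + c) (f * g)%thick.
Proof.
move=> Hf Hg n; have [linf hf] := Hf n; have [ling hg] := Hg n.
split=> [|m x Hx]; first exact: lin_comp.
by rewrite addrCA addrC; apply/hf/hg.
Qed.

Lemma thick_add A B e (f g : tmap A B) :
  is_thick e f -> is_thick e g -> is_thick e (f + g)%thick.
Proof.
move=> Hf Hg n; have [linf hf] := Hf n; have [ling hg] := Hg n.
split=> [|m x Hx]; first exact: lin_add.
by apply: thmgD; [exact: hf|exact: hg].
Qed.

Lemma thick_teps1 A B e (f : tmap A B) c n x :
  is_thick e f -> teps c (f n x) = ksgn k (c * e) *: f n (teps c x).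
Proof. by move=> Hf; have [linf hf] := Hf n; apply: thick_teps. Qed.

Lemma tsymD A n (s : 'S_n) (x y : TP A n) : tsym s (x + y) = tsym s x + tsym s y.
Proof. exact: (linD (@tsym_linear _ _ _ _)). Qed.

Lemma tp1V_linear A : linear (@tp1V k A).
Proof. exact/tlift_linear/tp1V_multilinear. Qed.

Lemma tp1_linear A : linear (@tp1 k A).
Proof.
move=> c x y; apply: (can_inj (@tp1VK k A)).
by rewrite tp1V_linear !tp1K.
Qed.

Lemma arity1_comp A B C (f : tmap B C) (g : tmap A B) a :
  arity1 (f * g)%thick a = arity1 f (arity1 g a).
Proof. by rewrite /arity1 tp1VK. Qed.

Lemma arity1_add A B (f g : tmap A B) a :
  arity1 (f + g)%thick a = arity1 f a + arity1 g a.
Proof. by rewrite /arity1 -(linD (@tp1V_linear _)). Qed.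

Lemma arity1_linear A B (f : tmap A B) : linear (f 1%N) -> linear (arity1 f).
Proof.
move=> linf; apply: (lin_comp (@tp1V_linear B)).
exact: (lin_comp linf (@tp1_linear A)).
Qed.

Lemma tdiff_tp1 A (d : A -> A) a : linear d -> tdiff d (tp1 a) = tp1 (d a).
Proof.
move=> lind; rewrite /tp1 tdiff_pure // big_ord1; congr pure; apply/ffunP => i.
by rewrite !ffunE ord1.
Qed.

Lemma arity1_hmg A B e (f : tmap A B) i (a : A) :
  is_thick e f -> hmg i a -> hmg (i + e) (arity1 f a).
Proof.
move=> Hf Ha; have [_ hf] := Hf 1%N.
have : thmg i (tp1 a).
  have := @thmg_pure k A 1 (fun=> i) [ffun=> a]; rewrite big_ord1; apply=> j.
  by rewrite ffunE.
move=> /hf[s [Es Hs]]; rewrite /arity1 Es (lin_sum (@tp1V_linear _)).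
elim: s Hs {Es} => [|u s IH] Hs; first by rewrite big_nil; apply: hmg0.
rewrite big_cons; apply: hmgD; last first.
  by apply: IH => v vs; apply: Hs; rewrite inE vs orbT.
have [deg [<- Hu]] := Hs u (mem_head _ _).
rewrite (linZ (@tp1V_linear _)) big_ord1 /tp1V.
by rewrite (tlift_pure _ (@tp1V_multilinear _ _)); apply: hmgZ.
Qed.

Lemma tcat_nilr A (u : TP A 0) a : tcat u (pure a : TP A 0) = u.
Proof.
apply: (tp_ext (F := fun u => tcat u (pure a)) (G := id)) u => //.
  exact: tcat_linearl.
by move=> b; rewrite tcat_pure; congr pure; apply/ffunP => -[].
Qed.

Lemma tcat_nill A (u : TP A 0) a : tcat (pure a : TP A 0) u = u.
Proof.
apply: (tp_ext (F := tcat (pure a)) (G := id)) u => //.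
  exact: tcat_linearr.
by move=> b; rewrite tcat_pure; congr pure; apply/ffunP => -[].
Qed.

(** For p = q = 0 the derivation rule at the empty tensor, which spans, reads dx = dx + dx. *)
Lemma derivation0 A e (d : tmap A A) x :
  (forall n, linear (d n)) -> tm_derivation e d -> d 0%N x = 0.
Proof.
move=> lind derd; have linz : linear (fun _ : TP A 0 => 0 : TP A 0).
  by move=> c y z; rewrite scaler0 addr0.
apply: (tp_ext (F := d 0%N) (G := fun=> 0)) x => // a.
have nil (b : {ffun 'I_0 -> A}) : b = a by apply/ffunP => -[].
have := derd 0%N 0%N (tcat (pure a) (pure a)).
rewrite tens0_tcat // tens_tcat // teps_pure [finfun _]nil !tcat_nilr tcat_nill.
by move=> /eqP; rewrite -subr_eq subrr eq_sym => /eqP.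
Qed.

(** Induction on the arity: the derivation rule with p = 1 expresses arity n + 1 by arities 1 and
    n. *)
Lemma derivation_ext A e (d d' : tmap A A) :
  (forall n, linear (d n)) -> (forall n, linear (d' n)) ->
  tm_derivation e d -> tm_derivation e d' ->
  (forall a, d 1%N (tp1 a) = d' 1%N (tp1 a)) -> d = d'.
Proof.
move=> lind lind' derd derd' d1.
apply: functional_extensionality_dep; elim=> [|n IH].
  apply/funext => x.
  by rewrite (derivation0 x lind derd) (derivation0 x lind' derd').
have E1 : d 1%N = d' 1%N by apply/funext => x; rewrite -(tp1VK x) d1.
by apply/funext => x; rewrite (derd 1%N n) (derd' 1%N n) E1 IH.
Qed.

(** Both sides are derivations of degree -1 and agree in arity 1. *)
Lemma tdiff_perturb A (d : A -> A) (t : tmap A A) : linear d ->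
  (forall n, linear (t n)) -> tm_derivation (-1) t ->
  forall n (x : TP A n), tdiff (fun a => d a + arity1 t a) x = tdiff d x + t n x.
Proof.
move=> lind lint dert n x.
have linD' : linear (fun a => d a + arity1 t a).
  exact: lin_add lind (arity1_linear (lint _)).
have ld m := @tdiff_linear k A d m lind.
have la m : linear (@tm_add k A A (fun n => @tdiff k A d n) t m).
  exact: lin_add (ld m) (lint m).
suff E : (@tdiff k A (fun a => d a + arity1 t a) : tmap A A) =
    tm_add (fun n => @tdiff k A d n) t by exact: (tmapE x E).
apply: (@derivation_ext A (-1)).
- by move=> m; exact: tdiff_linear.
- exact: la.
- by move=> p q y; apply: tdiff_tens.
- move=> p q y; rewrite [in LHS]/tm_add tdiff_tens // dert addrACA; congr (_ + _).
    apply: (tcat_ext (F := fun y => _ y + _ y)) y => [||u v].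
    + by apply: lin_add; exact: tens_linear.
    + by apply: tens_linear.
    + by rewrite !tens0_tcat // -(linD (@tcat_linearl _ _ _ _ _)).
  apply: (tcat_ext (F := fun y => _ y + _ y)) y => [||u v].
  + by apply: lin_add; exact: tens_linear.
  + by apply: tens_linear.
  + by rewrite !tens_tcat // -(linD (@tcat_linearr _ _ _ _ _)).
- by move=> a; rewrite /tm_add !tdiff_tp1 // (linD (@tp1_linear _)) /arity1 tp1VK.
Qed.

End ThickMaps.

(** * Thick maps of algebras over an operad *)

Section OperadicThickMaps.
Variables (k : comPzRingType) (O : operad k).
Implicit Types A B C : oalg_data O.

Lemma oalg_thick_one A : is_oalg_thick 0 (@tm_one k A : tmap A A).
Proof.
split=> [||n p mu x _]; [exact: thick_one|by []|].
by rewrite /arity1 tp1K mul0r ksgn_odd scale1r.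
Qed.

Lemma oalg_thick_comp A B C e c (f : tmap B C) (g : tmap A B) :
  is_oalg_thick e f -> is_oalg_thick c g -> is_oalg_thick (e + c) (f * g)%thick.
Proof.
move=> [Hf sf af] [Hg sg ag]; split.
- exact: thick_comp.
- by move=> n s x; rewrite /tm_comp sg sf.
- move=> n p mu x Hmu; have [linf _] := Hf 1%N.
  rewrite arity1_comp (ag _ p) // (linZ (arity1_linear linf)) (af _ p) // scalerA.
  by rewrite mulrDl ksgnD mulrC.
Qed.

Lemma oalg_thick_add A B e (f g : tmap A B) : is_oalg B ->
  is_oalg_thick e f -> is_oalg_thick e g -> is_oalg_thick e (f + g)%thick.
Proof.
move=> HB [Hf sf af] [Hg sg ag]; split.
- exact: thick_add.
- by move=> n s x; rewrite /tm_add sg sf tsymD.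
- move=> n p mu x Hmu; rewrite arity1_add (af _ p) // (ag _ p) //.
  by rewrite -scalerDr -(linD (aact_linearr HB mu)).
Qed.

Lemma perturb_diff A (t : tmap A A) : is_oalg A -> perturbation t ->
  forall n (x : TP A n), tdiff (@adiff _ _ (perturb t)) x =
    tdiff (@adiff _ _ A) x + t n x.
Proof.
move=> HA [[Ht _ _] dert _]; apply: tdiff_perturb => //.
- by have [] := adiffP HA.
- by move=> n; have [] := Ht n.
Qed.

Lemma perturbation_eq A (t : tmap A A) n (x : TP A n) : perturbation t ->
  tdiff (@adiff _ _ A) (t n x) + t n (tdiff (@adiff _ _ A) x) + t n (t n x) = 0.
Proof.
move=> [_ _ /(tmapE x)]; rewrite /tm_add /tm_diff /tm_comp /tm_zero.
by rewrite ksgn_odd /= scaleN1r opprK.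
Qed.

(** The structure maps are unchanged, so only the axioms on the differential call for an argument.
    Its square vanishes by the perturbation equation in arity 1; in the Leibniz rule the terms with
    t cancel because t is compatible with the action. *)
Lemma is_oalg_perturb A (t : tmap A A) :
  is_oalg A -> perturbation t -> is_oalg (perturb t).
Proof.
move=> HA Ht; have [lind hd dd] := adiffP HA.
have [[tht _ act] dert _] := Ht; have lint n := (tht n).1.
have lin1 := arity1_linear (lint 1%N).
pose D (a : A) : A := adiff a + arity1 t a.
have linD' : linear D by exact: lin_add lind lin1.
have PD n (x : TP A n) : tdiff D x = tdiff (@adiff _ _ A) x + t n x.
  exact: tdiff_perturb.
have DD a : D (D a) = 0.
  rewrite -[RHS](lin0 (@tp1V_linear k A)) -[LHS]tp1K; congr tp1V.
  rewrite -!tdiff_tp1 // !PD.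
  rewrite (linD (@tdiff_linear _ _ _ _ lind)) (linD (lint _)).
  rewrite !(tdiff_tp1 _ lind) dd (lin0 (@tp1_linear k A)) add0r.
  by rewrite addrA -(tdiff_tp1 a lind); apply: perturbation_eq.
split.
- split=> // i a Ha.
  by apply: hmgD; [exact: hd|exact: arity1_hmg Ha].
- exact: (aact_linearl HA).
- exact: (aact_linearr HA).
- exact: (aact_hmg HA).
- move=> n p mu x Hmu; rewrite [LHS](aact_diff HA x Hmu).
  have -> : tdiff (@adiff _ _ (perturb t)) x = tdiff (@adiff _ _ A) x + t n x.
    exact: PD.
  have -> : @adiff _ _ (perturb t) (aact mu x) =
      @adiff _ _ A (aact mu x) + arity1 t (aact mu x) by [].
  rewrite (act _ p) // [X in _ = _ - _ *: X](linD (aact_linearr HA mu)).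
  rewrite scalerDr opprD addrACA mulN1r; have -> : ksgn k (- p) = ksgn k p.
    by rewrite /ksgn abszN.
  by rewrite subrr addr0.
- exact: (aact_id HA).
- exact: (aact_sym HA).
- exact: (aact_comp HA).
Qed.
End OperadicThickMaps.

(** * The perturbed contraction *)

Lemma oalg_thick_inv (k : comPzRingType) (O : operad k) (A : oalg_data O)
    (f s : tmap A A) : is_thick 0 s ->
  (s * f = 1)%thick -> (f * s = 1)%thick ->
  is_oalg_thick 0 f -> is_oalg_thick 0 s.
Proof.
move=> Hs sf fs [Hf symf actf].
have sfK n x : s n (f n x) = x by exact: (tmapE x sf).
have fsK n x : f n (s n x) = x by exact: (tmapE x fs).
split=> // [n c x|n p mu x Hmu]; first by rewrite -[x in LHS]fsK -symf sfK.
rewrite mul0r ksgn_odd scale1r -{1}[x]fsK.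
have := actf n p mu (s n x) Hmu; rewrite mul0r ksgn_odd scale1r => <-.
by rewrite /arity1 tp1VK sfK tp1K.
Qed.

Section Perturbation.
Variables (k : comPzRingType) (O : operad k) (A B : oalg_data O).
Hypotheses (HA : is_oalg A) (HB : is_oalg B).
Variables (f : tmap A B) (g : tmap B A) (h t u : tmap A A).
Hypotheses (Hc : contraction f g h) (Ht : perturbation t).
Hypotheses (uth : is_thick 0 u) (ul : (u * (1 - h * t) = 1)%thick)
  (ur : ((1 - h * t) * u = 1)%thick).

#[local] Arguments f : clear implicits.
#[local] Arguments g : clear implicits.
#[local] Arguments h : clear implicits.
#[local] Arguments t : clear implicits.
#[local] Arguments u : clear implicits.

Let linf n : linear (f n). Proof. by case: (contr_f Hc) => /(_ n)[]. Qed.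
Let ling n : linear (g n). Proof. by case: (contr_g Hc) => /(_ n)[]. Qed.
Let linh n : linear (h n). Proof. by case: (contr_h Hc) => /(_ n)[]. Qed.
Let lint n : linear (t n). Proof. by case: (pert_t Ht) => /(_ n)[]. Qed.
Let linu n : linear (u n). Proof. by case: (uth n). Qed.
Let linad : linear (@adiff _ _ A). Proof. by case: (adiffP HA). Qed.

Let d n : lend (TP A n) := Lend (@tdiff_linear _ _ _ n linad).
Let tt n : lend (TP A n) := Lend (@lint n).
Let hh n : lend (TP A n) := Lend (@linh n).
Let uu n : lend (TP A n) := Lend (@linu n).
Let ee n : lend (TP A n) := Lend (lin_comp (@ling n) (@linf n)).
Let sg n : lend (TP A n) := Lend (@teps_linear k A n 1).

Let fg n x : f n (g n x) = x. Proof. exact: (tmapE x (contr_fg Hc)). Qed.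
Let hg n x : h n (g n x) = 0. Proof. exact: (tmapE x (contr_hg Hc)). Qed.
Let fh n x : f n (h n x) = 0. Proof. exact: (tmapE x (contr_fh Hc)). Qed.
Let dfE n x : tdiff (@adiff _ _ B) (f n x) = f n (tdiff (@adiff _ _ A) x).
Proof.
have := tmapE x (contr_df Hc); rewrite /tm_diff /tm_zero ksgn_odd scale1r.
by move/eqP; rewrite subr_eq0 => /eqP.
Qed.
Let dgE n x : tdiff (@adiff _ _ A) (g n x) = g n (tdiff (@adiff _ _ B) x).
Proof.
have := tmapE x (contr_dg Hc); rewrite /tm_diff /tm_zero ksgn_odd scale1r.
by move/eqP; rewrite subr_eq0 => /eqP.
Qed.

Let pc n : perturbed_contraction (d n) (tt n) (hh n) (ee n) (uu n).
Proof.
split; apply: lend_ext => x.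
- by rewrite /= fg.
- by rewrite /= fh (lin0 (@ling n)).
- by rewrite /= hg.
- exact: (tmapE x (contr_hh Hc)).
- by rewrite [LHS]dgE dfE.
- have := tmapE x (contr_dh Hc).
  by rewrite /tm_diff /= ksgn_odd scaleN1r opprK.
- exact: perturbation_eq.
- exact: (tmapE x ul).
- exact: (tmapE x ur).
Qed.

(** * The perturbed maps and their compatibility with the operad *)

Let v : tmap A A := (1 + t * u * h)%thick.
#[local] Arguments v : clear implicits.

Let f' : tmap A B := (f * v)%thick.
Let g' : tmap B A := (u * g)%thick.
Let h' : tmap A A := (u * h)%thick.
Let t' : tmap B B := (f * t * g')%thick.

#[local] Arguments f' : clear implicits.
#[local] Arguments g' : clear implicits.
#[local] Arguments h' : clear implicits.
#[local] Arguments t' : clear implicits.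

Let oht : is_oalg_thick 0 (1 - h * t)%thick.
Proof.
have -> : (1 - h * t = 1 + (fun n x => - (h n (t n x))))%thick by [].
apply: oalg_thick_add => //; first exact: oalg_thick_one.
have [thht syht act] : is_oalg_thick 0 (h * t)%thick.
  exact: (oalg_thick_comp (contr_h Hc) (pert_t Ht)).
split=> [n|n s x|n p mu x Hmu].
- have [lin hm] := thht n; split; first exact: lin_opp.
  by move=> m x Hx; rewrite -scaleN1r; apply: thmgZ; apply: hm.
- rewrite [h n _]syht.
  by rewrite /tm_comp (linN (@tsym_linear k A n s)).
- rewrite /arity1 (linN (@tp1V_linear _ _)) [X in - X](act n p mu x Hmu).
  by rewrite (linN (aact_linearr HA mu)) scalerN.
Qed.

Let ou : is_oalg_thick 0 u.
Proof. exact: oalg_thick_inv ul ur oht. Qed.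

Let ouh : is_oalg_thick 1 h'.
Proof. exact: (oalg_thick_comp ou (contr_h Hc)). Qed.

Let ov : is_oalg_thick 0 v.
Proof.
apply: oalg_thick_add => //; first exact: oalg_thick_one.
exact: (oalg_thick_comp (oalg_thick_comp (pert_t Ht) ou) (contr_h Hc)).
Qed.

Let of' : is_oalg_thick 0 f'.
Proof. exact: (oalg_thick_comp (contr_f Hc) ov). Qed.
Let og' : is_oalg_thick 0 g'.
Proof. exact: (oalg_thick_comp ou (contr_g Hc)). Qed.
Let ot' : is_oalg_thick (-1) t'.
Proof.
exact: (oalg_thick_comp (oalg_thick_comp (contr_f Hc) (pert_t Ht)) og').
Qed.

(** Since fg = 1, one has f = fe and g = eg; this exposes the elements ev and ue of the endomorphism
    ring, about which the ring identities speak. *)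
Let f'E n x : f' n x = f n ((ee n * (1 + tt n * uu n * hh n)) x).
Proof. by rewrite lendME [ee n _]/= fg. Qed.
Let g'E n x : g' n x = (uu n * ee n) (g n x).
Proof. by rewrite lendME [ee n _]/= fg. Qed.

Let fE n x : f n (ee n x) = f n x. Proof. by rewrite /= fg. Qed.

Let vlE n x : v n x = x + v n (t n (h n x)).
Proof.
have /(congr1 (fun F : lend _ => F x)) := pc_vl (pc n).
by rewrite mulrBr mulr1 lendBE => /eqP; rewrite subr_eq => /eqP.
Qed.

Let vrE n x : v n x - t n (h n (v n x)) = x.
Proof.
have /(congr1 (fun F : lend _ => F x)) := pc_vr (pc n).
by rewrite mulrBl mul1r.
Qed.

Let ulE n x : u n x = x + u n (h n (t n x)).
Proof.
have := tmapE x ul; rewrite /tm_comp /tm_sub (linB (@linu n)) => /eqP.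
by rewrite subr_eq => /eqP.
Qed.

Let urE n x : u n x = x + h n (t n (u n x)).
Proof. by have /eqP := tmapE x ur; rewrite /tm_comp subr_eq => /eqP. Qed.

Lemma perturbed_recursive_formulas : recursive_formulas f g h t f' g' h' t'.
Proof.
split; try by [case: of'|case: og'|case: ouh|case: ot'].
- by apply: tmapP => n x; rewrite /tm_add /tm_comp -(linD (@linf n)) -vlE.
- by apply: tmapP => n x; rewrite /tm_add /tm_comp -urE.
- by apply: tmapP => n x; rewrite /tm_add /tm_comp -ulE.
Qed.

(** The formulas say f1(1 - th) = f, (1 - ht)g1 = g and h1(1 - th) = h, which v and u solve; for
    [h1] the identity hv = uh is added. Thickness makes [f1] and [h1] linear, as subtracting under
    them requires. *)
Lemma recursive_formulas_unique f1 g1 h1 t1 :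
  recursive_formulas f g h t f1 g1 h1 t1 ->
  [/\ f1 = f', g1 = g', h1 = h' & t1 = t'].
Proof.
case=> f1th _ h1th _ Ef Eg Eh Et.
have Dg : g1 = g'.
  apply: tmapP => n x; have Ex := tmapE x Eg.
  rewrite -[LHS](tmapE (g1 n x) ul) /tm_comp /tm_sub; congr (u n _).
  by apply/eqP; rewrite subr_eq; apply/eqP; exact: Ex.
split=> //; last by rewrite Et Dg.
- apply: tmapP => n x; have linf1 := (f1th n).1.
  rewrite -{1}(vrE x) (linB linf1) (tmapE (v n x) Ef) /tm_add /tm_comp.
  by rewrite addrK.
- apply: tmapP => n x; have linh1 := (h1th n).1.
  rewrite -{1}(vrE x) (linB linh1) (tmapE (v n x) Eh) /tm_add /tm_comp addrK.
  exact: (congr1 (fun F : lend _ => F x) (pc_hv (pc n))).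
Qed.

Let dA n (x : TP A n) :
  tdiff (@adiff _ _ (perturb t)) x = (d n + tt n) x.
Proof. exact: perturb_diff. Qed.

(** * Splitting the maps of arity p + q along p and q *)

Let ee_tens p q : tensL q (ee p) * tensR p (ee q) = ee (p + q)%N.
Proof.
apply: lend_ext => x; rewrite -tens0E /= (contr_f_morphism Hc).
by rewrite (contr_g_morphism Hc) tens0_comp.
Qed.

Let odd_tens p q (F : lend (TP A q)) x :
  tens 1 id F x = (tensL q (sg p) * tensR p F) x.
Proof. by rewrite (tens1E (1 : lend (TP A p))) rmorph1 mul1r. Qed.

Let odd_tensN p q (F : lend (TP A q)) x :
  tens (-1) id F x = (tensL q (sg p) * tensR p F) x.
Proof.
by rewrite (tens_teps (@id_linear _ _) (lendP F)) -[RHS](tens0E (sg p) F).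
Qed.

Let d_tens p q :
  tensL q (d p) + tensL q (sg p) * tensR p (d q) = d (p + q)%N.
Proof.
apply: lend_ext => x.
by rewrite [RHS]tdiff_tens // [tens (-1) _ _ _](odd_tensN (d q)).
Qed.

Let t_tens p q :
  tensL q (tt p) + tensL q (sg p) * tensR p (tt q) = tt (p + q)%N.
Proof.
apply: lend_ext => x.
by rewrite [RHS](pert_derivation Ht) [tens (-1) _ _ _](odd_tensN (tt q)).
Qed.

Let pcpq p q : perturbed_contraction
  (tensL q (d p) + tensL q (sg p) * tensR p (d q))
  (tensL q (tt p) + tensL q (sg p) * tensR p (tt q))
  (hh (p + q)%N) (tensL q (ee p) * tensR p (ee q)) (uu (p + q)%N).
Proof. by rewrite d_tens t_tens ee_tens. Qed.

Let ss p : sg p * sg p = 1.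
Proof. by apply: lend_ext => x; rewrite lendME /= tepsD teps_even. Qed.

Let anticomm e (w : tmap A A) n (linw : linear (w n)) : is_thick e w ->
  odd (absz e) -> sg n * Lend linw = - (Lend linw * sg n).
Proof.
move=> wth we; apply: lend_ext => x; rewrite lendME /= (thick_teps1 _ _ wth).
by rewrite mul1r ksgn_odd we scaleN1r.
Qed.

Let s_d p : sg p * d p = - (d p * sg p).
Proof.
apply: (anticomm (e := -1) (w := fun n => @tdiff _ _ _ n)) => // n.
split=> [|m x]; first exact: tdiff_linear.
by case: (adiffP HA) => ? ? _; exact: tdiff_thmg.
Qed.

Let s_t p : sg p * tt p = - (tt p * sg p).
Proof. by apply: (anticomm (e := -1)) => //; case: (pert_t Ht). Qed.

Let s_h p : sg p * hh p = - (hh p * sg p).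
Proof. by apply: (anticomm (e := 1)) => //; case: (contr_h Hc). Qed.

Let s_e p : sg p * ee p = ee p * sg p.
Proof.
have [fth _ _] := contr_f Hc; have [gth _ _] := contr_g Hc.
apply: lend_ext => x; rewrite !lendME /= (thick_teps1 _ _ gth).
by rewrite (thick_teps1 _ _ fth) mulr0 ksgn_odd !scale1r.
Qed.

Let pseudol p q :
  (tensL q (hh p) - tensL q (sg p) * tensR p (hh q)) * hh (p + q)%N =
  tensL q (hh p) * (tensL q (sg p) * tensR p (hh q)).
Proof.
apply: lend_ext => x; have [E _] := contr_h_pseudo_derivation Hc x.
rewrite -tens1E -[RHS]E lendME lendBE; congr (_ - _).
exact: (esym (odd_tens _ _)).
Qed.

Let pseudor p q :
  hh (p + q)%N * (tensL q (hh p) - tensL q (sg p) * tensR p (hh q)) =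
  - (tensL q (hh p) * (tensL q (sg p) * tensR p (hh q))).
Proof.
apply: lend_ext => x; have [_ E] := contr_h_pseudo_derivation Hc x.
have -> : (- (tensL q (hh p) * (tensL q (sg p) * tensR p (hh q)))) x =
  - tens 1 (hh p) (hh q) x by rewrite tens1E.
rewrite -[RHS]E lendME lendBE; congr (hh _ (_ - _)).
exact: (esym (odd_tens _ _)).
Qed.

Lemma perturbed_f_morphism : tm_morphism f'.
Proof.
move=> p q; apply/funext => x.
have H := tensor_ev (@tensLR _ A p q) (ss p) (s_e p) (s_d p) (s_h p)
  (pc p) (pc q) (pcpq p q) (pseudol p q).
(* Applying f turns the identity for ev into one for f' = fev. *)
have := congr1 (fun F : lend _ => f (p + q)%N (F x)) H.
rewrite ee_tens t_tens -f'E -tens0E => ->.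
rewrite (contr_f_morphism Hc) tens0_comp //; try exact: lendP.
by congr (tens 0 _ _ x); apply/funext => y; rewrite f'E.
Qed.

Lemma perturbed_g_morphism : tm_morphism g'.
Proof.
move=> p q; apply/funext => x.
have H := tensor_ue (@tensLR _ A p q) (ss p) (s_e p) (s_d p) (s_t p) (s_h p)
  (pc p) (pc q) (pcpq p q) (pseudor p q).
(* Evaluating on the image of g turns the identity for ue into one for g' = ueg. *)
have := congr1 (fun F : lend _ => F (g (p + q)%N x)) H.
rewrite ee_tens -g'E -tens0E => ->.
rewrite (contr_g_morphism Hc) tens0_comp //; try exact: lendP.
by congr (tens 0 _ _ x); apply/funext => y; rewrite g'E.
Qed.

Lemma perturbed_h_pseudo_derivation : tm_pseudo_derivation h'.
Proof.
move=> p q x D; have DE y : D y =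
    (tensL q (uu p * hh p) - tensL q (sg p) * tensR p (uu q * hh q)) y.
  by rewrite /D lendBE; congr (_ - _); exact: (odd_tens (uu q * hh q)).
have KE : tens 1 (h' p) (h' q) x =
    (tensL q (uu p * hh p) * (tensL q (sg p) * tensR p (uu q * hh q))) x.
  by rewrite -tens1E.
rewrite DE KE; split.
  have := tensor_pseudo_derivationl (@tensLR _ A p q) (ss p) (s_t p)
    (pc p) (pc q) (pcpq p q) (pseudol p q).
  exact: (congr1 (fun F : lend _ => F x)).
rewrite DE; have := tensor_pseudo_derivationr (@tensLR _ A p q) (ss p) (s_t p)
  (s_h p) (pc p) (pc q) (pcpq p q) (pseudor p q).
exact: (congr1 (fun F : lend _ => F x)).
Qed.

Let eue n x : f n (u n (g n x)) = x.
Proof.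
have /(congr1 (fun F : lend _ => f n (F (g n x)))) := pc_eue (pc n).
by rewrite /= !fg.
Qed.

(** As f and g' are morphisms and t is a derivation, ftg' splits into t' ⊗ fg' + fg' ⊗ t', and fg' =
    1 by [eue]. *)
Lemma perturbed_t_derivation : tm_derivation (-1) t'.
Proof.
move=> p q x; have ling' n : linear (g' n) by case: og' => /(_ n)[].
rewrite {1}/t' {1}/tm_comp {1}/tm_comp perturbed_g_morphism.
rewrite (pert_derivation Ht) (linD (@linf _)) (contr_f_morphism Hc).
have fte : linear (fun y => f p (teps (-1) y)).
  exact: lin_comp (@linf p) (@teps_linear _ _ _ _).
have ft n : linear (fun y => f n (t n y)) by exact: lin_comp (@linf n) (@lint n).
rewrite (tens_teps (@id_linear _ _) (@lint q)) !tens0_comp //;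
  last exact: teps_linear.
congr (_ + _).
  by congr (tens 0 _ _ x); apply/funext => y; exact: eue.
have lint' : linear (t' q) by case: ot' => /(_ q)[].
rewrite (tens_teps (@id_linear _ _) lint').
congr (tens 0 _ _ x); apply/funext => y.
(* The map g' has degree 0, so the sign operator commutes with it. *)
have [g'th _ _] := og'; have := thick_teps1 (-1) y g'th.
by rewrite mulr0 ksgn_odd scale1r => ->; exact: eue.
Qed.

Lemma perturbed_perturbation : perturbation t'.
Proof.
split; [exact: ot'|exact: perturbed_t_derivation|].
apply: tmapP => n x; rewrite /tm_add /tm_diff /tm_comp /tm_zero.
have -> : ksgn k (-1) = -1 by rewrite ksgn_odd.
rewrite scaleN1r opprK.
(* Between f and g the element etue becomes t', and its equation that of t'. *)
have /(congr1 (fun F : lend _ => f n (F (g n x)))) := pc_dt_ue (pc n).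
rewrite (lin0 (@linf n)) => <-.
by rewrite /t' /tm_comp /= !(linD (@linf n)) !dgE !fg !dfE.
Qed.

(** Once f' and g' are written with ev and ue, each equation is an identity in the ring
    [lend (TP A n)], evaluated at x or at gx, with f applied when the values lie in B. *)
Lemma perturbed_contraction_oalg :
  @contraction k O (perturb t) (perturb t') f' g' h'.
Proof.
have dB n (x : TP B n) :
    tdiff (@adiff _ _ (perturb t')) x = tdiff (@adiff _ _ B) x + t' n x.
  exact: perturb_diff HB perturbed_perturbation n x.
have appf n x (F G : lend (TP A n)) : F = G -> f n (F x) = f n (G x) by move->.
have app n x (F G : lend (TP A n)) : F = G -> F x = G x by move->.
have linu' n : linear (g' n) by case: og' => /(_ n)[].
split.
- exact: of'.
- exact: og'.
- exact: ouh.
- apply: tmapP => n x; rewrite /tm_diff /tm_zero ksgn_odd scale1r.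
  rewrite [X in X - _]dB [X in _ - f' n X]dA.
  apply/eqP; rewrite subr_eq0; apply/eqP; symmetry; rewrite f'E -lendME.
  rewrite (appf _ _ _ _ (pc_ev_d (pc n))) f'E.
  rewrite /t' /tm_comp g'E.
  by rewrite /= !(linD (@linf n)) dgE !fg.
- apply: tmapP => n x; rewrite /tm_diff /tm_zero ksgn_odd scale1r.
  rewrite [X in X - _]dA [X in _ - g' n X]dB.
  apply/eqP; rewrite subr_eq0; apply/eqP; rewrite g'E -lendME.
  rewrite (app _ _ _ _ (pc_d_ue (pc n))) (linD (linu' n)) !g'E.
  by rewrite /= dgE !fg.
- apply: tmapP => n x; rewrite /tm_diff /tm_comp /tm_sub /tm_one.
  have -> : ksgn k 1 = -1 by rewrite ksgn_odd.
  rewrite scaleN1r opprK dA [X in _ + h' n X]dA.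
  rewrite g'E f'E -[h' n x]/((uu n * hh n) x) -lendME.
  rewrite [X in _ + X]/((uu n * hh n * (d n + tt n)) x).
  rewrite [LHS](app _ x _ _ (pc_d_uh (pc n))) lendBE; congr (_ - _).
  by rewrite /= !fg.
- apply: tmapP => n x; rewrite /tm_comp f'E g'E -lendME.
  by rewrite (appf _ _ _ _ (pc_evue (pc n))) fE fg.
- apply: tmapP => n x; rewrite /tm_comp f'E -[h' n x]/((uu n * hh n) x) -lendME.
  by rewrite (appf _ _ _ _ (pc_evuh (pc n))) (lin0 (@linf n)).
- by apply: tmapP => n x; exact: (app _ x _ _ (pc_huhn (pc n))).
- apply: tmapP => n x; rewrite /tm_comp g'E.
  exact: (app _ (g n x) _ _ (pc_uhue (pc n))).
- exact: perturbed_f_morphism.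
- exact: perturbed_g_morphism.
- exact: perturbed_h_pseudo_derivation.
Qed.

End Perturbation.

(** The inverse of 1 - ba is 1 + bsa for s inverse to 1 - ab; the degrees of a and b are opposite,
    so it has degree 0. *)
Lemma tm_invertible_swap (k : comPzRingType) (O : operad k) (A : oalg_data O)
    e (a b : tmap A A) : is_thick e a -> is_thick (- e) b ->
  tm_invertible (1 - a * b)%thick -> tm_invertible (1 - b * a)%thick.
Proof.
move=> Ha Hb [s [Hs sl sr]]; exists (1 + b * s * a)%thick; split.
- apply: thick_add; first exact: thick_one.
  by have := thick_comp (thick_comp Hb Hs) Ha; rewrite addr0 addNr.
- apply: tmapP => n x; have lina := (Ha n).1; have linb := (Hb n).1.
  rewrite /tm_comp /tm_add /tm_sub /tm_one (linB lina).
  by rewrite [s n _](tmapE (a n x) sl) subrK.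
- apply: tmapP => n x; have lina := (Ha n).1; have linb := (Hb n).1.
  have /eqP := tmapE (a n x) sr.
  rewrite /tm_comp /tm_sub /tm_one subr_eq => /eqP E.
  rewrite /tm_comp /tm_add /tm_sub /tm_one (linD lina) -E.
  by rewrite addrK.
Qed.

Theorem theorem1p3 (k : comPzRingType) (O : operad k) (A B : oalg_data O)
    (HA : is_oalg A) (HB : is_oalg B)
    (f : tmap A B) (g : tmap B A) (h : tmap A A) (Hc : contraction f g h)
    (t : tmap A A) (Ht : perturbation t) :
  (tm_invertible (1 - h * t)%thick <-> tm_invertible (1 - t * h)%thick) /\
  (tm_invertible (1 - h * t)%thick ->
   exists (f' : tmap A B) (g' : tmap B A) (h' : tmap A A) (t' : tmap B B),
     recursive_formulas f g h t f' g' h' t' /\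
     (forall f1 g1 h1 t1, recursive_formulas f g h t f1 g1 h1 t1 ->
        [/\ f1 = f', g1 = g', h1 = h' & t1 = t']) /\
     perturbation t' /\
     is_oalg (perturb t) /\
     is_oalg (perturb t') /\
     @contraction k O (perturb t) (perturb t') f' g' h').

Proof.
have [hth _ _] := contr_h Hc; have [tth _ _] := pert_t Ht.
split.
  by split; apply: tm_invertible_swap; [exact: hth | exact: tth..| exact: hth].
case=> u [uth ul ur].
(* These are fv, ug, uh and ftug, with v = 1 + tuh the inverse of 1 - th. *)
exists (f * (1 + t * u * h))%thick, (u * g)%thick, (u * h)%thick,
  (f * t * (u * g))%thick.
have Hp := perturbed_perturbation HA Hc Ht uth ul ur.
split; first exact: (perturbed_recursive_formulas HA Hc Ht uth ul ur).
split=> [f1 g1 h1 t1|].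
  exact: (recursive_formulas_unique HA Hc Ht uth ul ur).
split=> //; split; first exact: (is_oalg_perturb HA Ht).
split; first exact: (is_oalg_perturb HB Hp).
exact: (perturbed_contraction_oalg HA HB Hc Ht uth ul ur).
Qed.
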